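(* For all positive integers $n$ and integers $k\ge 0$, \[S_{n,k}=\begin{cases}\displaystyle\sum_{C\in\mathcal S_{n,k}}t^{\mathsf{area}(C)} & \text{if } n-k \text{ is odd},\\[2mm] 0 & \text{if } n-k\text{ is even},\end{cases}\] where $\mathsf{area}(C)$ denotes the common area of all paths in the class $C$.
   Context: Paths. A square path of size $n$ is a lattice path from $(0,0)$ to $(n,n)$ of unit north (vertical) and east (horizontal) steps whose last step is east. The $j$-th diagonal is the set of unit squares with two vertices on $y=x+j$. Each vertical step is identified with the unit square of which it is the left edge. Area word: $a_i=j$ if the $i$-th vertical step starts on $y=x+j$. Shift $s=-\min_i a_i$; area $=\sum_i(a_i+s)$. A labeling is a word $w=w_1\cdots w_n$ of positive integers ($w_i$ in the square of the $i$-th vertical step) strictly increasing upward within each column; standard if the labels are $1,\dots,n$. The $i$-th vertical step is a contractible valley if ($i>1$ and $a_{i-1}>a_i$) or ($i>1$, $a_{i-1}=a_i$, $w_{i-1}<w_i$) or ($i=1$ and $a_1\le-1$). A decorated labeled square path $(\pi,w,dv)$ has $dv$ a set of contractible valleys (decorated steps); $\mathsf{LSQ}(n)^{\bullet k}$ is the set of those with exactly $k$ decorations and $\mathsf{stLSQ}(n)^{\bullet k}$ the standardly labeled ones. Attack pair: $i<j$ with $i\notin dv$ and either ($a_i=a_j$, $w_i<w_j$) or ($a_i=a_j+1$, $w_i>w_j$). $\mathsf{dinv}(P)=\#\{\text{attack pairs}\}+\#\{i:a_i<0\}-k$. $S_{n,k}=\sum_{P\in\mathsf{stLSQ}(n)^{\bullet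 k}}(-1)^{\mathsf{dinv}(P)}t^{\mathsf{area}(P)}$. Schedule word. For $P\in\mathsf{stLSQ}(n)^{\bullet k}$ with shift $s$, let $\rho_i$ be the labels in the $(i-s)$-th diagonal in decreasing order, each marked decorated if its step is decorated; the diagonal word is $\mathsf{dw}(P)=\rho_0\rho_1\cdots$, a decorated permutation. For a decorated permutation $\sigma$ with maximal decreasing runs $\rho_0\cdots\rho_l$, $\tilde\rho_i$ the undecorated letters of $\rho_i$ ($\rho_{l+1}=\emptyset$), and shift $s\in\{0,\dots,l\}$, the schedule number of $c\in\rho_i$ is $\#\{d\in\tilde\rho_i:d>c\}+1$ if $i=s$ and $c$ undecorated; $\#\{d\in\tilde\rho_i:d>c\}+\#\{d\in\tilde\rho_{i-1}:d<c\}$ if $i>s$ and $c$ undecorated; $\#\{d\in\tilde\rho_i:d<c\}+\#\{d\in\tilde\rho_{i+1}:d>c\}$ if $i<s$ or $c$ decorated (all $0$ if $s>l$). The schedule word $\mathsf{sched}(P)$ lists the schedule numbers of the letters of $(\mathsf{dw}(P),s)$; $\mathsf{sched}(P)=1^n$ means they all equal $1$. Cutting. For $P\in\mathsf{LSQ}(n)^{\bullet k}$ and $i\in[n]$, write $P=P_1P_2$ where $P_1$ ends with the $i$-th east step, and let $\psi_i(P)=P_2P_1$ (steps carrying their labels and decorations). The cutting cycle is $\mathcal{CC}(P)=\{\psi_i(P):i\in[n]\}\cap\mathsf{LSQ}(n)^{\bullet k}$ (those $\psi_i(P)$ that are valid decorated labeled square paths). Write $P\sim Q$ iff $Q\in\mathcal{CC}(P)$;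 this is an equivalence relation whose classes share a common area. $\mathcal S_{n,k}=\{P\in\mathsf{stLSQ}(n)^{\bullet k}:\mathsf{sched}(P)=1^n\}/\sim$. *)

(* Defs.v *)
From HB Require Import structures.
From mathcomp Require Import all_boot all_order all_algebra.

Set Implicit Arguments.
Unset Strict Implicit.
Unset Printing Implicit Defensive.

Import Order.TTheory GRing.Theory Num.Theory.
Local Open Scope ring_scope.

(* A decorated labeled lattice path (pi, w, dv) is stored as one sequence of
   steps carrying their labels and decorations:
     None        == an east step,
     Some (c, b) == a north step with label c, decorated iff b.
   The index i of a north step starts at 0 instead of 1. *)
Definition step := option (nat * bool).
Definition lpath := seq step.

Definition is_north (x : step) : bool := isSome x.
Definition is_east (x : step) : bool := ~~ isSome x.

Section Paths.
Local Open Scope nat_scope.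
Implicit Types (P : lpath) (i j m : nat).

(* The starting point of the m-th step of P (m counted from 0). *)
Definition xcoord P m : nat := count is_east (take m P).
Definition ycoord P m : nat := count is_north (take m P).

Definition north_pos P : seq nat :=
  [seq m <- iota 0 (size P) | is_north (nth None P m)].
Definition east_pos P : seq nat :=
  [seq m <- iota 0 (size P) | is_east (nth None P m)].

Definition area_word P : seq int :=
  [seq ((ycoord P m)%:Z - (xcoord P m)%:Z)%R | m <- north_pos P].
Definition columns P : seq nat := [seq xcoord P m | m <- north_pos P].
Definition letters P : seq (nat * bool) := pmap id P.
Definition labels P : seq nat := [seq x.1 | x <- letters P].
Definition decs P : seq bool := [seq x.2 | x <- letters P].

Definition aw P i : int := nth 0%R (area_word P) i.
Definition col P i : nat := nth 0 (columns P) i.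
Definition lab P i : nat := nth 0 (labels P) i.
Definition dec P i : bool := nth false (decs P) i.

Definition nb_north P : nat := count is_north P.
Definition nb_dec P : nat := count id (decs P).

(* In a path starting at (0,0) the first vertical step starts on or below the
   main diagonal, so the minimum is <= 0 and the absolute value of its opposite
   is this opposite. *)
Definition shift P : nat :=
  absz (- \big[Order.min/aw P 0]_(a <- area_word P) a)%R.

(* Each summand is nonnegative. *)
Definition area P : nat := absz (\sum_(a <- area_word P) (a + (shift P)%:Z))%R.

Definition square_path n P : bool :=
  [&& size P == n + n, nb_north P == n & is_east (last None P)].

Definition labeling P : bool :=
  all (fun c => 0 < c) (labels P) &&
  [forall i : 'I_(nb_north P), forall j : 'I_(nb_north P),
     (i < j) && (col P i == col P j) ==> (lab P i < lab P j)].

Definition contractible P i : bool :=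
  if i is i'.+1 then
    (aw P i < aw P i')%R || ((aw P i' == aw P i) && (lab P i' < lab P i))
  else (aw P 0 <= -1)%R.

Definition LSQ n k P : bool :=
  [&& square_path n P, labeling P,
      [forall i : 'I_(nb_north P), dec P i ==> contractible P i]
    & nb_dec P == k].

Definition standard n P : bool := perm_eq (labels P) (iota 1 n).

Definition attack P i j : bool :=
  [&& i < j, ~~ dec P i
    & ((aw P i == aw P j) && (lab P i < lab P j))
      || ((aw P i == (aw P j + 1)%R) && (lab P j < lab P i))].

Definition nb_attack P : nat :=
  #|[set ij : 'I_(nb_north P) * 'I_(nb_north P) | attack P ij.1 ij.2]|.

Definition dinv P : int :=
  ((nb_attack P)%:Z + (count (fun a : int => a < 0) (area_word P))%:Z
   - (nb_dec P)%:Z)%R.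

End Paths.

Section Schedule.
Local Open Scope nat_scope.
Implicit Types (P : lpath) (sigma : seq (nat * bool)) (rs : seq (seq (nat * bool))).

Definition rho P i : seq (nat * bool) :=
  sort (fun x y => y.1 <= x.1)
    [seq v.2 | v <- zip (area_word P) (letters P)
             & v.1 == (i%:Z - (shift P)%:Z)%R].

(* For a square path of size n the area word has entries in [-n, n), so adding
   the shift gives entries in [0, 2n) = [0, size P) and the omitted rho P i are
   empty. *)
Definition dw P : seq (nat * bool) :=
  flatten [seq rho P i | i <- iota 0 (size P)].

(* Maximal decreasing runs of a decorated word. *)
Fixpoint runs sigma : seq (seq (nat * bool)) :=
  if sigma is x :: sigma' then
    if runs sigma' is (y :: r) :: rs then
      if y.1 < x.1 then (x :: y :: r) :: rs else [:: x] :: (y :: r) :: rs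
    else [:: [:: x]]
  else [::].

(* The undecorated letters of the i-th run; empty past the last run. *)
Definition urun rs i : seq nat := [seq d.1 | d <- nth [::] rs i & ~~ d.2].

Definition sched_num rs (s i : nat) (c : nat * bool) : nat :=
  if (i < s) || c.2 then
    count (fun d => d < c.1) (urun rs i) + count (fun d => c.1 < d) (urun rs i.+1)
  else if i == s then
    count (fun d => c.1 < d) (urun rs i) + 1
  else
    count (fun d => c.1 < d) (urun rs i) + count (fun d => d < c.1) (urun rs i.-1).

Definition sched_word sigma (s : nat) : seq nat :=
  let rs := runs sigma in
  if s < size rs then
    flatten [seq [seq sched_num rs s i c | c <- nth [::] rs i]
            | i <- iota 0 (size rs)]
  else nseq (size sigma) 0.

Definition sched P : seq nat := sched_word (dw P) (shift P).

End Schedule.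

Section Cutting.
Local Open Scope nat_scope.
Implicit Types P Q : lpath.

(* The index i ranges over 1, ..., n: the prefix moved to the end is the one
   ending with the i-th east step. *)
Definition psi i P : lpath :=
  let m := (nth 0 (east_pos P) i.-1).+1 in drop m P ++ take m P.

Definition CC n k P : seq lpath :=
  [seq Q <- [seq psi i P | i <- iota 1 n] | LSQ n k Q].

Definition cut_equiv n k P Q : bool := Q \in CC n k P.

End Cutting.

(* Standardly labeled paths of size n have labels < n.+1, so they live in the
   finite type [stpath n]; [to_lpath] is the (injective) embedding. *)
Definition stpath (n : nat) := ((n + n)%N).-tuple (option ('I_n.+1 * bool)).

Definition to_lpath (n : nat) (P : stpath n) : lpath :=
  [seq omap (fun x : 'I_n.+1 * bool => (nat_of_ord x.1, x.2)) y | y <- P].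

Definition stLSQ (n k : nat) : {set stpath n} :=
  [set P : stpath n | LSQ n k (to_lpath P) && standard n (to_lpath P)].

Definition S_poly (n k : nat) : {poly int} :=
  \sum_(P in stLSQ n k) ((-1 : int) ^ dinv (to_lpath P)) *: 'X^(area (to_lpath P)).

Definition sched_one (n k : nat) : {set stpath n} :=
  [set P in stLSQ n k | sched (to_lpath P) == nseq n 1%N].

Definition cut_classes (n k : nat) : {set {set stpath n}} :=
  equivalence_partition
    (fun P Q : stpath n => cut_equiv n k (to_lpath P) (to_lpath Q))
    (sched_one n k).

(* The area is constant on cutting classes: read it off any representative. *)
Definition class_area (n : nat) (C : {set stpath n}) : nat :=
  if [pick P in C] is Some P then area (to_lpath P) else 0%N.

(* Main.v *)
From HB Require Import structures.
From mathcomp Require Import all_boot all_order all_algebra.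
From mathcomp Require Import zify ring.
Require Import Defs.
Import Order.TTheory GRing.Theory Num.Theory.

Set Implicit Arguments.
Unset Strict Implicit.
Unset Printing Implicit Defensive.

(* A path of shift [s] is encoded by the word of its letters (level, label,
   decoration), where level = area word entry + s.  Recording the cut of the
   cyclic path as one more decorated letter, of level [s] and of label larger
   than all others, turns the validity of a path into the condition that
   consecutive letters of a cyclic word are compatible.  Inserting the letters
   one at a time (decorated ones last) proves that the paths with a given set of
   letters and shift [s] have attack generating function
   q^(decorated letters of level >= s) * prod [schedule number]_q.
     At q = -1 this is a sign if all schedule numbers are odd, and 0 otherwise.
   If they are all odd then they are all 1: every level has at most two
   undecorated letters, consecutive levels interlace, and the level [s] has a
   single undecorated letter; the same then holds for every other level with a
   single undecorated letter.  The signs of these levels alternate, so their sum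
   is 1 or 0 according to the parity of n - k.  Finally, for each of these shifts
   there is exactly one path with the given letters, and any two of them are
   cuts of each other. *)

Local Open Scope nat_scope.

(** * Insertions and gap sums *)

Definition insert (T : Type) (j : nat) (c : T) (u : seq T) : seq T :=
  take j u ++ c :: drop j u.

Lemma path_insert (T : Type) (e : rel T) j c u p z :
  (forall x, e (last p (take j u)) c -> e c x -> x = head z (drop j u) ->
     e (last p (take j u)) x) ->
  path e p (rcons (insert j c u) z) =
  [&& path e p (rcons u z), e (last p (take j u)) c & e c (head z (drop j u))].
Proof.
rewrite /insert; move: (take j u) (drop j u) (cat_take_drop j u) => v w <- e_trans.
rewrite !rcons_cat !cat_path rcons_cons /=.
case: w e_trans => [|x w] /=; case: (e _ c); rewrite ?andbF // => /(_ _ isT);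
  case cx: (e c _) => e_trans; rewrite ?andbF ?andbT //=;
  by rewrite e_trans ?andbT.
Qed.

Section InsertEqType.
Variable T : eqType.
Implicit Types (c : T) (u X : seq T).

Lemma perm_insert j c u : perm_eq (insert j c u) (c :: u).
Proof. by rewrite /insert -cat1s perm_catCA cat1s cat_take_drop. Qed.

Lemma index_insert j c u : c \notin u -> j <= size u -> index c (insert j c u) = j.
Proof.
move=> cNu ju; rewrite index_cat /= eqxx addn0 size_takel // ifN //.
by apply: contra cNu; apply: mem_take.
Qed.

Lemma filter_predC1_insert j c u :
  c \notin u -> [seq x <- insert j c u | x != c] = u.
Proof.
move=> cNu; rewrite filter_cat /= eqxx -filter_cat cat_take_drop.
by apply/all_filterP/allP => x xu; apply: contraNneq cNu => <-.
Qed.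

Lemma perm_permutations_cons c X : c \notin X ->
  perm_eq (permutations (c :: X))
    [seq insert j c u | u <- permutations X, j <- iota 0 (size u).+1].
Proof.
move=> cNX; have cNu u : u \in permutations X -> c \notin u.
  by rewrite mem_permutations => /perm_mem->.
apply: uniq_perm; first exact: permutations_uniq.
  apply: allpairs_uniq_dep => [|u _|]; rewrite ?permutations_uniq ?iota_uniq //.
  move=> _ _ /allpairsPdep[u [i [uX iu ->]]] /allpairsPdep[v [j [vX jv ->]]] /= E.
  have uv : u = v.
    by rewrite -(filter_predC1_insert i (cNu u uX)) E filter_predC1_insert ?cNu.
  rewrite {}uv in uX iu E *; rewrite !mem_iota !ltnS in iu jv.
  by rewrite -(index_insert (cNu v vX) iu) E index_insert ?cNu.
move=> w; rewrite mem_permutations.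
apply/idP/allpairsPdep => [pw|[u [j [uX _ ->]]]]; last first.
  by rewrite (perm_trans (perm_insert j c u)) // perm_cons -mem_permutations.
have /splitPr wE : c \in w by rewrite (perm_mem pw) mem_head.
case: wE pw => u v pw; exists (u ++ v), (size u); split.
- by rewrite mem_permutations -(perm_cons c) -(permPr pw) -cat1s perm_catCA.
- by rewrite mem_iota size_cat ltnS leq_addr.
- by rewrite /insert take_size_cat // drop_size_cat.
Qed.

End InsertEqType.

Lemma hasN_count (T : Type) (a : pred T) u : ~~ has a u -> count a u = 0.
Proof. by rewrite has_count -eqn0Ngt => /eqP. Qed.

Lemma cycle_remove (T : Type) (e : rel T) c u v :
  (forall p x, e p c -> e c x -> e p x) -> cycle e (u ++ c :: v) -> cycle e (u ++ v).
Proof.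
move=> e_trans; rewrite -(rot_cycle (size u)) -[in X in _ -> X](rot_cycle (size u)).
rewrite !rot_size_cat /=; case: (v ++ u) => [|x w] //=.
by rewrite !rcons_path => /andP[cx /andP[-> /e_trans->]].
Qed.

Section GapSums.
Variables (R : comNzRingType) (q : R) (T : Type).
Implicit Types (before after A : pred T) (u : seq T) (p z : T).
Local Open Scope ring_scope.

Definition qint (w : nat) : R := \sum_(0 <= i < w) q ^+ i.

Lemma qint0 : qint 0 = 0.
Proof. by rewrite /qint big_geq. Qed.

Lemma qintS w : qint w.+1 = qint w + q ^+ w.
Proof. by rewrite /qint big_nat_recr. Qed.

Lemma qintSl w : qint w.+1 = 1 + q * qint w.
Proof.
rewrite /qint big_nat_recl // expr0 mulr_sumr; congr (_ + _).
by apply: eq_bigr => i _; rewrite exprS.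
Qed.

Definition gap_sum before after (f : seq T -> seq T -> nat) p u z : R :=
  \sum_(0 <= j < (size u).+1)
    (before (last p (take j u)) && after (head z (drop j u)))%:R
    * q ^+ f (take j u) (drop j u).

Lemma gap_sum_nil before after f p z :
  gap_sum before after f p [::] z = (before p && after z)%:R * q ^+ f [::] [::].
Proof. by rewrite /gap_sum /= big_nat1. Qed.

Lemma gap_sum_cons before after f p y u z :
  gap_sum before after f p (y :: u) z =
  (before p && after y)%:R * q ^+ f [::] (y :: u)
  + gap_sum before after (fun a b => f (y :: a) b) y u z.
Proof. by rewrite /gap_sum /= big_nat_recl. Qed.

Lemma gap_sum_addl before after m f p u z :
  gap_sum before after (fun a b => m + f a b)%N p u z
  = q ^+ m * gap_sum before after f p u z.
Proof. by rewrite mulr_sumr; apply: eq_bigr => j _; rewrite exprD; ring. Qed.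

(* Every gap [(p, x)] contributes [before p - ~~ after x], and
   [before y = ~~ after y + A y] makes the sum telescope. *)
Lemma gap_sum_between before after A p u z :
  all (fun y => if A y then before y && after y else before y == ~~ after y) u ->
  path (fun p x => before p || after x) p (rcons u z) ->
  gap_sum before after (fun a _ => count A a) p u z
  + (~~ after z)%:R * q ^+ count A u
  = (before p)%:R + q * qint (count A u).
Proof.
elim: u p => [|y u IH] p /=.
  rewrite gap_sum_nil /= qint0 expr0 !mulr1 mulr0 addr0 andbT => _.
  by case: (before p); case: (after z) => //= _; ring.
move=> /andP[y_ok u_ok] /andP[py_ok yu_ok]; rewrite gap_sum_cons /= expr0 mulr1.
rewrite gap_sum_addl exprD mulrCA -addrA -mulrDr (IH _ u_ok yu_ok).
case: (A y) y_ok => /=; rewrite ?addn1 ?add1n ?add0n ?expr1 ?expr0 ?mul1r.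
  by move=> /andP[-> ->]; rewrite andbT qintSl mulr1n.
move=> /eqP->; case: (before p) (after y) py_ok => [] [] //= _.
  by rewrite mulr1n mulr0n; ring.
all: by rewrite mulr0n ?mulr1n; ring.
Qed.

Lemma gap_sum_right before after A p u z :
  all (fun y => before y == A y) u -> all after u -> after z ->
  gap_sum before after (fun _ b => count A b) p u z
  = (before p)%:R * q ^+ count A u + qint (count A u).
Proof.
elim: u p => [|y u IH] p /=.
  by move=> _ _ z_ok; rewrite gap_sum_nil z_ok /= qint0 andbT addr0.
move=> /andP[/eqP yA uA] /andP[y_ok u_ok] z_ok.
rewrite gap_sum_cons /= y_ok andbT IH // yA.
by case: (A y); rewrite ?add1n ?add0n ?qintS ?mulr1n ?mulr0n; ring.
Qed.

Lemma gap_sum_left before after A p u z :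
  all (fun y => after y == A y) u -> all before u -> before p ->
  gap_sum before after (fun a _ => count A a) p u z
  = (after z)%:R * q ^+ count A u + qint (count A u).
Proof.
elim: u p => [|y u IH] p /=.
  by move=> _ _ p_ok; rewrite gap_sum_nil p_ok /= qint0 addr0.
move=> /andP[/eqP yA uA] /andP[y_ok u_ok] p_ok.
rewrite gap_sum_cons /= p_ok yA gap_sum_addl IH //.
by case: (A y); rewrite ?add1n ?add0n ?qintSl ?exprS ?expr0 ?mulr1n ?mulr0n; ring.
Qed.

End GapSums.

Lemma qintN1 w : qint (-1 : int)%R w = (odd w)%:R%R.
Proof.
elim: w => [|w IH]; first by rewrite qint0.
by rewrite qintS IH -signr_odd /=; case: (odd w).
Qed.

Lemma qint1 w : qint (1 : int)%R w = w%:R%R.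
Proof.
by elim: w => [|w IH]; rewrite ?qint0 // qintS IH expr1n natr1.
Qed.

(** * Letters, attacks and the insertion of one letter *)

Definition letter := (nat * (nat * bool))%type.
Definition level (x : letter) : nat := x.1.
Definition label (x : letter) : nat := x.2.1.
Definition decorated (x : letter) : bool := x.2.2.

Definition follows (p x : letter) : bool :=
  if decorated x then
    (level x < level p) || ((level x == level p) && (label p <= label x))
  else (level x <= level p) || ((level x == (level p).+1) && (label p < label x)).

Definition attacks (x y : letter) : bool :=
  ~~ decorated x && (((level x == level y) && (label x < label y))
                     || ((level x == (level y).+1) && (label y < label x))).

Fixpoint nattacks (u : seq letter) : nat :=
  if u is x :: u' then count (attacks x) u' + nattacks u' else 0.

Definition labels_lt (N : nat) (u : seq letter) : bool :=
  all (fun d => label d < N) u.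

(* The place where a cyclic word over labels smaller than [N] is cut open. *)
Definition marker (N s : nat) : letter := (s, (N, true)).

Definition valid (N s : nat) (u : seq letter) : bool :=
  cycle follows (marker N s :: u).

Lemma follows_trans_decorated c p x :
  decorated c -> follows p c -> follows c x -> follows p x.
Proof. by rewrite /follows => ->; case: (decorated x); lia. Qed.

Lemma follows_marker N s c : label c < N ->
  follows c (marker N s) = (s <= level c).
Proof. by case: c => l [b d]; rewrite /follows /level /label /=; lia. Qed.

Lemma marker_follows N s c : label c < N ->
  follows (marker N s) c = (level c < s) || ((level c == s) && ~~ decorated c).
Proof. by case: c => l [b []]; rewrite /follows /level /label /=; lia. Qed.

Lemma nattacks_cat_cons u v c :
  nattacks (u ++ c :: v) =
  nattacks (u ++ v) + count (attacks^~ c) u + count (attacks c) v.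
Proof. by elim: u => [|x u IH] //=; rewrite ?IH ?count_cat /=; lia. Qed.

Lemma nattacks_insert j c u :
  nattacks (insert j c u) =
  nattacks u + count (attacks^~ c) (take j u) + count (attacks c) (drop j u).
Proof. by rewrite /insert nattacks_cat_cons cat_take_drop. Qed.

Definition crossings (T : Type) (r : rel T) (A B : seq T) (c : T) : nat :=
  count (r c) A + count (r^~ c) B.

Definition ulevel (X : seq letter) (i : nat) : seq nat :=
  [seq label d | d <- X & ~~ decorated d && (level d == i)].

Definition schedule (s : nat) (X : seq letter) (c : letter) : nat :=
  if (level c < s) || decorated c then
    crossings gtn (ulevel X (level c)) (ulevel X (level c).+1) (label c)
  else if level c == s then (count (ltn (label c)) (ulevel X (level c))).+1
  else crossings ltn (ulevel X (level c)) (ulevel X (level c).-1) (label c).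

Lemma count_ulevel X i (f : pred nat) :
  count f (ulevel X i) =
  count (fun d => [&& f (label d), ~~ decorated d & level d == i]) X.
Proof. by rewrite count_map count_filter. Qed.

Lemma count_crossings (a : pred letter) X (r : rel nat) i j v :
  {in X, forall d, nat_of_bool (a d) =
     ~~ decorated d && ((level d == i) && r v (label d))
     + ~~ decorated d && ((level d == j) && r (label d) v)} ->
  count a X = crossings r (ulevel X i) (ulevel X j) v.
Proof.
rewrite /crossings !count_ulevel; elim: X => [|x X IH] //= aE.
rewrite (aE x) ?mem_head // IH; last by move=> d dX; apply: aE; rewrite inE dX orbT.
by case: (r v _); case: (r _ v); lia.
Qed.

(* Decorated letters are inserted last; the undecorated ones come by increasing
   levels in the levels >= s, then by decreasing levels in the levels < s. *)
Definition inserted_after (s : nat) (c d : letter) : bool :=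
  decorated c || ~~ decorated d &&
  (if level c < s then
     [|| s <= level d, level c < level d
       | (level d == level c) && (label d <= label c)]
   else (s <= level d) &&
     ((level d < level c) || ((level d == level c) && (label c <= label d)))).

Definition insertable (s : nat) (c d : letter) : bool :=
  (label d != label c) && inserted_after s c d.

Lemma insertable_ge s c d : s <= level c -> ~~ decorated c -> insertable s c d ->
  [&& s <= level d, ~~ decorated d
    & (level d < level c) || ((level d == level c) && (label c < label d))].
Proof.
rewrite /insertable /inserted_after ltnNge => -> /negbTE-> /=.
by case: (decorated d); lia.
Qed.

Lemma insertable_lt s c d : level c < s -> ~~ decorated c -> insertable s c d ->
  ~~ decorated d &&
  ((level c < level d) || ((level d == level c) && (label d < label c))).
Proof.
rewrite /insertable /inserted_after => lt_c_s /negbTE->; rewrite lt_c_s /=.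
by case: (decorated d); lia.
Qed.

Lemma follows_trans N s c p x : label c < N ->
  (p == marker N s) || insertable s c p && (label p < N) ->
  (x == marker N s) || insertable s c x ->
  follows p c -> follows c x -> follows p x.
Proof.
move=> ltcN pP xP; have [|cU] := boolP (decorated c).
  exact: follows_trans_decorated.
move: pP xP; rewrite /insertable /inserted_after (negbTE cU) /=.
case: x => xl [xb xd]; case: p => pl [pb pd]; case: c cU ltcN => cl [cb cd].
rewrite /follows /marker /level /label /decorated /= => /negbTE-> ltcN.
case/orP => [/eqP[-> -> _]|pP]; case/orP => [/eqP[-> -> ->]|xP];
  try (move: pP); try (move: xP);
  try (case: xd => //); try (case: pd => //); try case: ifP; lia.
Qed.

Lemma mem_head_cons (T : eqType) (z : T) (s : seq T) : head z s \in z :: s.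
Proof. by case: s => [|x s]; rewrite ?inE ?eqxx ?orbT. Qed.

Lemma valid_insert N s c u j : label c < N -> labels_lt N u -> all (insertable s c) u ->
  valid N s (insert j c u) =
  [&& valid N s u, follows (last (marker N s) (take j u)) c
    & follows c (head (marker N s) (drop j u))].
Proof.
move=> ltcN /allP ltuN /allP cu; rewrite /valid /=; apply: path_insert => x pc cx xE.
apply: (follows_trans (N := N) (s := s)) pc cx => //.
  have := mem_last (marker N s) (take j u); rewrite inE => /orP[->//|/mem_take pu].
  by rewrite cu ?ltuN ?orbT.
have := mem_head_cons (marker N s) (drop j u); rewrite -xE inE => /orP[->//|/mem_drop xu].
by rewrite cu ?orbT.
Qed.

Section InsertionSum.
Variables (R : comNzRingType) (q : R) (N s : nat) (c : letter) (u : seq letter).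
Hypotheses (ltcN : label c < N) (ltuN : labels_lt N u).
Hypotheses (cu : all (insertable s c) u) (u_valid : valid N s u).
Local Open Scope ring_scope.

Let m := marker N s.

Local Notation insertion_sum :=
  (\sum_(0 <= j < (size u).+1 | valid N s (insert j c u)) q ^+ nattacks (insert j c u)).

Lemma insertion_sumE f :
  (forall j, nattacks (insert j c u) = nattacks u + f (take j u) (drop j u))%N ->
  insertion_sum = q ^+ nattacks u * gap_sum q (follows^~ c) (follows c) f m u m.
Proof.
move=> fE; rewrite big_mkcond mulr_sumr; apply: eq_bigr => j _.
rewrite valid_insert // u_valid /= -/m fE.
by case: (_ && _); rewrite ?mul1r ?mul0r ?mulr0 ?exprD.
Qed.

Lemma insertion_sum_attacked : ~~ has (attacks c) u ->
  insertion_sum = q ^+ nattacks u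
    * gap_sum q (follows^~ c) (follows c) (fun a _ => count (attacks^~ c) a) m u m.
Proof.
move=> /hasPn cNu; apply: insertion_sumE => j; rewrite nattacks_insert.
by rewrite (@hasN_count _ (attacks c)) ?addn0 //; apply/hasPn => x /mem_drop/cNu.
Qed.

Lemma insertion_sum_attacking : ~~ has (attacks^~ c) u ->
  insertion_sum = q ^+ nattacks u
    * gap_sum q (follows^~ c) (follows c) (fun _ b => count (attacks c) b) m u m.
Proof.
move=> /hasPn cNu; apply: insertion_sumE => j; rewrite nattacks_insert.
by rewrite (@hasN_count _ (attacks^~ c)) ?addn0 //; apply/hasPn => x /mem_take/cNu.
Qed.

Lemma insertion_sum_decorated : decorated c ->
  insertion_sum =
  q ^+ nattacks u * (q ^+ (s <= level c)%N * qint q (schedule s u c)).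
Proof.
move=> c_dec; rewrite insertion_sum_attacked; last first.
  by apply/hasPn => x _; rewrite /attacks c_dec.
congr (_ * _).
have schedE : schedule s u c = count (attacks^~ c) u.
  rewrite /schedule c_dec orbT; apply/esym/count_crossings => d /(allP cu).
  by rewrite /attacks /insertable; case: (decorated d) => /=; lia.
have gap_ok : path (fun p x => follows p c || follows c x) m (rcons u m).
  have neq_label : {in m :: rcons u m, forall y, label y != label c}.
    move=> y; rewrite inE mem_rcons inE orbA orbb => /predU1P[->|/(allP cu)/andP[]//].
    by rewrite neq_ltn ltcN orbT.
  have : path follows m (rcons u m) by exact: u_valid.
  apply: sub_in_path (allss _) => p x pm xm.
  have := neq_label p pm; have := neq_label x xm.
  by rewrite /follows c_dec; case: (decorated x); lia.
have /(gap_sum_between q (A := attacks^~ c))/(_ gap_ok) :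
    all (fun y => if attacks y c then follows y c && follows c y
                  else follows y c == ~~ follows c y) u.
  apply/allP => y /(allP cu); rewrite /insertable /inserted_after /attacks /follows c_dec.
  by case: (decorated y) => /=; try case: ifP; lia.
rewrite -schedE follows_marker // marker_follows // c_dec andbF orbF.
case: leqP => _ /=; rewrite ?mul0r ?addr0 ?add0r ?mul1r ?expr0 ?expr1 //.
by rewrite -qintSl qintS; apply: addIr.
Qed.

Lemma insertion_sum_ge : (s <= level c)%N -> ~~ decorated c ->
  insertion_sum = q ^+ nattacks u * qint q (schedule s u c).
Proof.
move=> le_s_c cU; have cu_ge d (du : d \in u) := insertable_ge le_s_c cU (allP cu d du).
rewrite insertion_sum_attacking; last first.
  by apply/hasPn => d /cu_ge; rewrite /attacks; lia.
congr (_ * _); rewrite (gap_sum_right q (A := attacks c)).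
- have -> : schedule s u c = (count (attacks c) u + (level c == s))%N.
    rewrite /schedule (negbTE cU) orbF ltnNge le_s_c /=; case: eqP => [cs|_].
      rewrite addn1 count_ulevel; congr _.+1; apply: eq_in_count => d /cu_ge.
      by rewrite /attacks /=; lia.
    by rewrite addn0; apply/esym/count_crossings => d /cu_ge; rewrite /attacks; lia.
  rewrite marker_follows // ltnNge le_s_c cU andbT /=.
  by case: (_ == _); rewrite ?addn0 ?mul0r ?add0r // addn1 mul1r qintS addrC.
- by apply/allP => d /cu_ge; rewrite /attacks /follows (negbTE cU); lia.
- by apply/allP => d /cu_ge; rewrite /follows; case: (decorated d); lia.
- by rewrite follows_marker.
Qed.

Lemma insertion_sum_lt : (level c < s)%N -> ~~ decorated c ->
  insertion_sum = q ^+ nattacks u * qint q (schedule s u c).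
Proof.
move=> lt_c_s cU; have cu_lt d (du : d \in u) := insertable_lt lt_c_s cU (allP cu d du).
rewrite insertion_sum_attacked; last first.
  by apply/hasPn => d /cu_lt; rewrite /attacks; lia.
congr (_ * _); rewrite (gap_sum_left q (A := attacks^~ c)).
- rewrite follows_marker // leqNgt lt_c_s mul0r add0r.
  congr (qint _ _); rewrite /schedule lt_c_s.
  by apply: count_crossings => d /cu_lt; rewrite /attacks; lia.
- by apply/allP => d /cu_lt; rewrite /attacks /follows; case: (decorated d); lia.
- by apply/allP => d /cu_lt; rewrite /follows (negbTE cU); lia.
- by rewrite marker_follows // lt_c_s.
Qed.

Lemma insertion_sum_schedule :
  insertion_sum =
  q ^+ nattacks u * (q ^+ (decorated c && (s <= level c)%N) * qint q (schedule s u c)).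
Proof.
have [c_dec|cU] := boolP (decorated c); first exact: insertion_sum_decorated.
by rewrite mul1r; have [/insertion_sum_lt|/insertion_sum_ge] := ltnP (level c) s; apply.
Qed.

End InsertionSum.

(** * The schedule formula *)

Lemma perm_ulevel X Y i : perm_eq X Y -> perm_eq (ulevel X i) (ulevel Y i).
Proof. by move=> XY; apply/perm_map/perm_filter. Qed.

Lemma perm_schedule s X Y c : perm_eq X Y -> schedule s X c = schedule s Y c.
Proof.
move=> XY; have countE i a : count a (ulevel X i) = count a (ulevel Y i).
  exact/permP/perm_ulevel.
by rewrite /schedule /crossings !countE.
Qed.

Lemma schedule_cons s c X d : insertable s c d -> schedule s (c :: X) d = schedule s X d.
Proof.
rewrite /insertable /inserted_after /schedule /crossings !count_ulevel /=.
case: (decorated c) => /=; first by rewrite !andbF.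
by case: (decorated d); rewrite ?andbF //= ?orbF; repeat case: ifP; lia.
Qed.

Lemma schedule_cons_self s c X : schedule s (c :: X) c = schedule s X c.
Proof. by rewrite /schedule /crossings !count_ulevel /= !ltnn. Qed.

Lemma insertable_exists s X : X != [::] -> uniq (map label X) ->
  exists c X', perm_eq X (c :: X') /\ all (insertable s c) X'.
Proof.
move=> Xn0 uniqX.
have total_after : total (inserted_after s).
  by move=> x y; rewrite /inserted_after; case: (decorated x); case: (decorated y) => //=;
    repeat case: ifP; lia.
have trans_after : transitive (inserted_after s).
  move=> y x z; rewrite /inserted_after.
  by case: (decorated x); case: (decorated y); case: (decorated z) => //=;
    repeat case: ifP; lia.
have := sort_sorted total_after X; have : perm_eq X (sort (inserted_after s) X).
  by rewrite perm_sym perm_sort.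
case: (sort _ X) => [|c X'] permX /=; first by rewrite (perm_nilP permX) in Xn0.
move=> /(order_path_min trans_after)/allP c_after; exists c, X'; split=> //.
move: uniqX; rewrite (perm_uniq (perm_map label permX)) => /= /andP[cNX' _].
apply/allP => d dX'; rewrite /insertable c_after // andbT.
by apply: contraNneq cNX' => <-; apply: map_f.
Qed.

Section ScheduleFormula.
Variables (R : comNzRingType) (q : R) (N s : nat).
Local Open Scope ring_scope.

Definition attack_sum (X : seq letter) : R :=
  \sum_(u <- permutations X | valid N s u) q ^+ nattacks u.

Definition schedule_prod (X : seq letter) : R :=
  \prod_(c <- X) qint q (schedule s X c).

Lemma perm_attack_sum X Y : perm_eq X Y -> attack_sum X = attack_sum Y.
Proof. by move=> XY; apply: perm_big (perm_permutations XY). Qed.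

Lemma perm_schedule_prod X Y : perm_eq X Y -> schedule_prod X = schedule_prod Y.
Proof.
move=> XY; rewrite /schedule_prod (perm_big _ XY).
by apply: eq_bigr => c _; rewrite (perm_schedule _ _ XY).
Qed.

Lemma attack_sum_cons c X :
  c \notin X -> labels_lt N (c :: X) -> all (insertable s c) X ->
  attack_sum (c :: X) =
  q ^+ (decorated c && (s <= level c)%N) * qint q (schedule s X c) * attack_sum X.
Proof.
move=> cNX /andP[ltcN ltXN] c_last.
rewrite /attack_sum (perm_big _ (perm_permutations_cons cNX)) big_flatten big_map.
rewrite mulr_sumr [RHS]big_mkcond; apply: eq_big_seq => u.
rewrite mem_permutations => permu.
have ltuN : labels_lt N u by rewrite /labels_lt (perm_all _ permu).
have cu : all (insertable s c) u by rewrite (perm_all _ permu).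
rewrite big_map -[(size u).+1]subn0; case: ifPn => u_valid; last first.
  by rewrite big1 // => j; rewrite valid_insert // (negbTE u_valid).
by rewrite insertion_sum_schedule // (perm_schedule _ _ permu) mulrC.
Qed.

Lemma schedule_prod_cons c X : all (insertable s c) X ->
  schedule_prod (c :: X) = qint q (schedule s X c) * schedule_prod X.
Proof.
move=> c_last; rewrite /schedule_prod big_cons schedule_cons_self; congr (_ * _).
by apply: eq_big_seq => d dX; rewrite schedule_cons // (allP c_last).
Qed.

Theorem schedule_formula X : uniq (map label X) -> labels_lt N X ->
  attack_sum X =
  q ^+ count (fun c => decorated c && (s <= level c)%N) X * schedule_prod X.
Proof.
have [m] := ubnP (size X); elim: m X => // m IH X ltXm uniqX ltXN.
have [->|Xn0] := eqVneq X [::].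
  rewrite /attack_sum (_ : permutations [::] = [:: [::]]) // /schedule_prod !big_cons.
  by rewrite !big_nil /valid /= /follows /= eqxx leqnn orbT !expr0 mulr1 addr0.
have [c [X' [permX c_last]]] := insertable_exists s Xn0 uniqX.
move: ltXm ltXN uniqX; rewrite /labels_lt (perm_size permX) (perm_all _ permX).
rewrite (perm_uniq (perm_map label permX)) => /= ltX'm ltXN /andP[cNX' uniqX'].
have /andP[_ ltX'N] := ltXN.
rewrite (perm_attack_sum permX) (perm_schedule_prod permX) (permP permX) /=.
rewrite schedule_prod_cons // attack_sum_cons ?IH ?exprD //; first by ring.
by apply: contra cNX'; apply: map_f.
Qed.

End ScheduleFormula.

(** * Interlacing levels *)

Definition interlaces (T : Type) (r : rel T) (Q : pred nat) (A B : seq T) : bool :=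
  all (fun c => Q (crossings r A B c)) A.

Lemma crossings_converse (T : Type) (r : rel T) A B c :
  crossings (fun x y => r y x) B A c = crossings r A B c.
Proof. exact: addnC. Qed.

Lemma perm_interlaces (T : eqType) (r : rel T) Q A A' B B' :
  perm_eq A A' -> perm_eq B B' -> interlaces r Q A B = interlaces r Q A' B'.
Proof.
move=> AA' BB'; rewrite /interlaces (perm_all _ AA'); apply: eq_all => c.
by rewrite /crossings (permP AA') (permP BB').
Qed.

Definition strict_total (T : eqType) (r : rel T) : Prop :=
  [/\ irreflexive r, transitive r & forall x y, x != y -> r x y || r y x].

Lemma ltn_strict_total : strict_total ltn.
Proof.
by split=> [x|y x z|x y]; [rewrite /= ltnn|apply: ltn_trans|rewrite /= neq_ltn].
Qed.

Lemma gtn_strict_total : strict_total gtn.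
Proof.
split=> [x|y x z /= xy yz|x y]; first by rewrite /= ltnn.
  exact: ltn_trans yz xy.
by rewrite /= neq_ltn orbC.
Qed.

Section Interlacing.
Variables (T : eqType) (r : rel T).
Hypothesis r_order : strict_total r.
Implicit Types (A B : seq T) (Q : pred nat).

Let r_irr : irreflexive r. Proof. by case: r_order. Qed.
Let r_trans : transitive r. Proof. by case: r_order. Qed.
Let r_total x y : x != y -> r x y || r y x. Proof. by case: r_order => _ _; apply. Qed.

Let r_asym x y : r x y -> r y x = false.
Proof. by move=> xy; apply: contraFF (r_irr x); apply: r_trans. Qed.

Lemma uniq_descending A : uniq A ->
  exists2 A', perm_eq A A' & pairwise (fun x y => r y x) A'.
Proof.
move=> uniqA; pose ge x y := (x == y) || r y x.
have ge_total : total ge.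
  by move=> x y; rewrite /ge eq_sym; case: eqVneq => //= /r_total; rewrite orbC.
exists (sort ge A); first by rewrite perm_sym perm_sort.
have : pairwise ge (sort ge A).
  rewrite -sorted_pairwise ?sort_sorted // => y x z.
  by rewrite /ge => /predU1P[->//|yx] /predU1P[<-|zy]; rewrite ?yx ?(r_trans zy yx) orbT.
have : uniq (sort ge A) by rewrite sort_uniq.
elim: (sort ge A) => //= x l IH /andP[xNl uniql] /andP[xl /(IH uniql)->]; rewrite andbT.
by apply/allP => y yl; have /predU1P[xy|//] := allP xl y yl; rewrite xy yl in xNl.
Qed.

Lemma count_above_descending A1 x A2 : pairwise (fun x y => r y x) (A1 ++ x :: A2) ->
  count (r x) (A1 ++ x :: A2) = size A1.
Proof.
rewrite pairwise_cat /= allrel_consr => /and4P[/andP[A1x _] _ /allP A2x _].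
move: A1x; rewrite all_count count_cat => /eqP->.
rewrite /= r_irr (@hasN_count _ (r x)) ?addn0 //.
by apply/hasPn => y /A2x/r_asym->.
Qed.

Lemma size_odd_above A : uniq A -> all (fun x => odd (count (r x) A).+1) A -> size A <= 1.
Proof.
move=> /uniq_descending[A' permA descA]; rewrite (perm_size permA) (perm_all _ permA).
case: A' permA descA => [|x [|y A']] // permA descA /and3P[_ + _].
by rewrite (permP permA) (@count_above_descending [:: x] _ _ descA).
Qed.

Lemma leq_count_below x y B : r x y -> count (r^~ x) B <= count (r^~ y) B.
Proof. by move=> xy; apply: sub_count => z zx; apply: r_trans xy. Qed.

(* List [A] in decreasing order as [x], [y], ...: the first summands of the crossings
   are 0, 1, ... and the second ones are weakly decreasing and at most 2, so that
   parity leaves no room for a third entry. *)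
Lemma interlaces_odd A B : uniq A -> size B <= 2 -> interlaces r odd A B ->
  interlaces r (pred1 1) A B /\ size A <= 2.
Proof.
move=> /uniq_descending[A' permA descA] B_le2; rewrite (perm_size permA).
rewrite !(perm_interlaces _ _ permA (perm_refl _)) {permA A} => /allP crossings_odd.
have below_le2 x : count (r^~ x) B <= 2 by apply: leq_trans (count_size _ _) B_le2.
case: A' descA crossings_odd => [|x [|y A']] // descA crossings_odd.
  have := crossings_odd x (mem_head _ _); have := below_le2 x.
  by rewrite /interlaces /crossings /= r_irr andbT; split=> //; lia.
have [x_above y_above] := (@count_above_descending [::] _ _ descA,
  @count_above_descending [:: x] _ _ descA).
have yx : r y x by case/and3P: descA => /andP[].
have x_crosses : crossings r [:: x, y & A'] B x = 1.
  have := crossings_odd x (mem_head _ _); have := below_le2 x.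
  by rewrite /crossings x_above /=; lia.
have y_crosses : crossings r [:: x, y & A'] B y = 1.
  have := crossings_odd y; rewrite !inE eqxx orbT => /(_ isT).
  have := leq_count_below B yx.
  by move: x_crosses; rewrite /crossings x_above y_above /=; lia.
case: A' descA {x_above} y_above crossings_odd x_crosses y_crosses =>
  [|z A'] descA y_above.
  by rewrite /interlaces /= => _ -> ->.
have z_above := @count_above_descending [:: x; y] _ _ descA.
have zy : r z y by case/and4P: descA => _ /andP[].
move=> /(_ z); rewrite !inE eqxx !orbT => /(_ isT) + _; have := leq_count_below B zy.
by rewrite /crossings y_above z_above /=; lia.
Qed.

Lemma interlaces_nil A : uniq A -> interlaces r (pred1 1) A [::] -> A = [::].
Proof.
move=> /uniq_descending[[|x A'] permA descA]; first by move/perm_nilP: permA.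
rewrite (perm_interlaces _ _ permA (perm_refl _)) /interlaces /crossings => /andP[+ _].
by rewrite (@count_above_descending [::] _ _ descA).
Qed.

Lemma crossings_le2 A B c : uniq A -> size A <= 2 -> size B <= 2 ->
  interlaces r (pred1 1) A B -> crossings r A B c <= 2.
Proof.
move=> /uniq_descending[A' permA descA]; rewrite (perm_size permA).
rewrite (perm_interlaces _ _ permA (perm_refl _)) /crossings (permP permA).
move=> {A permA} A_le2 B_le2; have := leq_trans (count_size (r^~ c) B) B_le2.
have below x : r c x -> count (r^~ c) B <= count (r^~ x) B by apply: leq_count_below.
case: A' descA A_le2 => [|x [|y []]] //= descA _;
  rewrite /interlaces /crossings /= !r_irr.
  by have := below x; case: (r c x); lia.
have /andP[/andP[/r_asym-> _] _] := descA.
by have := below x; have := below y; case: (r c x); case: (r c y); lia.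
Qed.

Lemma interlaces_converse A B :
  uniq A -> uniq B -> 0 < size A <= 2 -> 0 < size B <= 2 ->
  interlaces r (pred1 1) A B -> interlaces (fun x y => r y x) (pred1 1) B A.
Proof.
move=> /uniq_descending[A' permA descA] /uniq_descending[B' permB descB].
rewrite (perm_size permA) (perm_size permB).
rewrite (perm_interlaces _ _ permA permB) (perm_interlaces _ _ permB permA).
rewrite /interlaces /crossings {permA permB A B}.
case: A' descA => [|x [|y []]] //=; case: B' descB => [|z [|t []]] //=;
  rewrite !andbT !r_irr.
- by lia.
- by move=> tz _ _ _; rewrite tz (r_asym tz); have := @r_trans _ _ x tz; lia.
- by move=> _ yx _ _; rewrite yx (r_asym yx); have := @r_trans _ z _ _ yx; lia.
move=> tz yx _ _; rewrite tz yx (r_asym tz) (r_asym yx); have := @r_trans _ _ x tz.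
have := @r_trans _ _ y tz; have := @r_trans _ z _ _ yx.
by have := @r_trans _ t _ _ yx; lia.
Qed.

Lemma interlaces_odd_chain (L : nat -> seq T) m :
  (forall j, uniq (L j)) -> size (L 0) <= 2 ->
  (forall j, j < m -> interlaces r odd (L j.+1) (L j)) ->
  (forall j, j < m -> interlaces r (pred1 1) (L j.+1) (L j))
  /\ (forall j, j <= m -> size (L j) <= 2).
Proof.
move=> uniqL L0_le2 L_odd; have L_le2 j : j <= m -> size (L j) <= 2.
  elim: j => // j IH ltjm.
  by have [] := interlaces_odd (uniqL j.+1) (IH (ltnW ltjm)) (L_odd j ltjm).
split=> // j ltjm.
by have [] := interlaces_odd (uniqL j.+1) (L_le2 j (ltnW ltjm)) (L_odd j ltjm).
Qed.

Lemma interlaces_nil_chain (L : nat -> seq T) m :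
  (forall j, uniq (L j)) -> L 0 = [::] ->
  (forall j, j < m -> interlaces r (pred1 1) (L j.+1) (L j)) ->
  forall j, j <= m -> L j = [::].
Proof.
move=> uniqL L0 L_one; elim=> // j IH ltjm.
by apply: interlaces_nil => //; rewrite -(IH (ltnW ltjm)); apply: L_one.
Qed.

End Interlacing.

(** * Words all of whose schedule numbers are odd *)

Lemma ulevel_uniq X i : uniq (map label X) -> uniq (ulevel X i).
Proof. by apply: subseq_uniq; apply/map_subseq/filter_subseq. Qed.

Lemma ulevelP X i v :
  reflect (exists c, [/\ c \in X, ~~ decorated c, level c = i & label c = v])
    (v \in ulevel X i).
Proof.
apply: (iffP mapP) => [[c]|[c [cX cU levelc labelc]]].
  by rewrite mem_filter => /andP[/andP[cU /eqP levelc] cX] ->; exists c.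
by exists c; rewrite // mem_filter cU levelc eqxx.
Qed.

Definition schedules (Q : pred nat) (s : nat) (X : seq letter) : bool :=
  all (fun c => Q (schedule s X c)) X.

Lemma perm_schedules Q s X Y : perm_eq X Y -> schedules Q s X = schedules Q s Y.
Proof.
move=> XY; rewrite /schedules (perm_all _ XY).
by apply: eq_all => c; rewrite (perm_schedule _ _ XY).
Qed.

Lemma schedulesP (Q : pred nat) s X :
  reflect [/\ forall i, i < s -> interlaces gtn Q (ulevel X i) (ulevel X i.+1),
              all (fun v => Q (count (ltn v) (ulevel X s)).+1) (ulevel X s),
              forall i, s <= i -> interlaces ltn Q (ulevel X i.+1) (ulevel X i)
            & {in X, forall c, decorated c ->
                Q (crossings gtn (ulevel X (level c)) (ulevel X (level c).+1) (label c))}]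
    (schedules Q s X).
Proof.
apply: (iffP allP) => [Q_sched|[Q_below Q_at Q_above Q_dec] c cX].
  split=> [i lt_i_s||i le_s_i|c cX c_dec]; last first.
  - by have := Q_sched c cX; rewrite /schedule c_dec orbT.
  - apply/allP => _ /ulevelP[c [cX cU levelc <-]].
    have := Q_sched c cX; rewrite /schedule levelc (negbTE cU) orbF ltnNge leqW //=.
    by rewrite gtn_eqF.
  - apply/allP => _ /ulevelP[c [cX cU levelc <-]].
    by have := Q_sched c cX; rewrite /schedule levelc ltnn eqxx (negbTE cU).
  apply/allP => _ /ulevelP[c [cX cU levelc <-]].
  by have := Q_sched c cX; rewrite /schedule levelc lt_i_s.
rewrite /schedule; have [c_dec|cU] := boolP (decorated c); first by rewrite orbT Q_dec.
have c_in : label c \in ulevel X (level c) by apply/ulevelP; exists c.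
rewrite orbF; case: ltngtP => [lt_c_s|lt_s_c|eq_c_s].
- exact: (allP (Q_below _ lt_c_s)).
- have := Q_above (level c).-1; rewrite -ltnS prednK; last exact: leq_ltn_trans lt_s_c.
  by move=> /(_ lt_s_c)/allP; apply.
by rewrite eq_c_s in c_in *; exact: (allP Q_at).
Qed.

Lemma schedules_one_odd s X : schedules (pred1 1) s X -> schedules odd s X.
Proof. by apply: sub_all => c /eqP->. Qed.

Section Levels.
Variables (X : seq letter) (s : nat).
Hypothesis uniqX : uniq (map label X).

Let uniq_ulevel i : uniq (ulevel X i). Proof. exact: ulevel_uniq. Qed.

Lemma schedules_odd_levels : schedules odd s X ->
  [/\ forall i, i < s -> interlaces gtn (pred1 1) (ulevel X i) (ulevel X i.+1),
      size (ulevel X s) <= 1,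
      forall i, s <= i -> interlaces ltn (pred1 1) (ulevel X i.+1) (ulevel X i)
    & forall i, size (ulevel X i) <= 2].
Proof.
move=> /schedulesP[odd_below odd_at odd_above _].
have level_s : size (ulevel X s) <= 1.
  exact: (size_odd_above ltn_strict_total (uniq_ulevel s)).
have up_chain m : (forall j, j < m ->
    interlaces ltn (pred1 1) (ulevel X (s + j).+1) (ulevel X (s + j)))
    /\ (forall j, j <= m -> size (ulevel X (s + j)) <= 2).
  have := @interlaces_odd_chain _ _ ltn_strict_total (fun j => ulevel X (s + j)) m.
  rewrite addn0; case=> [|||up_one up_le2] //; first exact: leqW.
    by move=> j _; rewrite addnS odd_above ?leq_addr.
  by split=> // j ltjm; rewrite -addnS up_one.
have down_chain : (forall j, j < s ->
    interlaces gtn (pred1 1) (ulevel X (s - j.+1)) (ulevel X (s - j)))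
    /\ (forall j, j <= s -> size (ulevel X (s - j)) <= 2).
  have := @interlaces_odd_chain _ _ gtn_strict_total (fun j => ulevel X (s - j)) s.
  rewrite subn0; apply=> // [|j ltjs]; first exact: leqW.
  by have := odd_below (s - j.+1); rewrite -subSn // subSS => -> //; lia.
split=> // i.
- move=> lt_i_s; have := down_chain.1 (s - i.+1).
  by rewrite subnSK // !subKn ?(ltnW lt_i_s) //; apply; lia.
- by move=> le_s_i; have := (up_chain (i - s).+1).1 (i - s) (leqnn _); rewrite subnKC.
have [le_s_i|lt_i_s] := leqP s i.
  by have := (up_chain (i - s)).2 _ (leqnn _); rewrite subnKC.
by have := down_chain.2 (s - i) (leq_subr _ _); rewrite subKn // ltnW.
Qed.

Lemma ulevel_nil_above i j : i <= j ->
  (forall l, i <= l -> interlaces ltn (pred1 1) (ulevel X l.+1) (ulevel X l)) ->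
  ulevel X i = [::] -> ulevel X j = [::].
Proof.
move=> le_ij one_above level_i; rewrite -(subnKC le_ij).
have := @interlaces_nil_chain _ _ ltn_strict_total (fun l => ulevel X (i + l)) (j - i).
apply=> //; first by rewrite addn0.
by move=> l _; rewrite addnS one_above ?leq_addr.
Qed.

Lemma ulevel_nil_below i j : i <= j ->
  (forall l, l < j -> interlaces gtn (pred1 1) (ulevel X l) (ulevel X l.+1)) ->
  ulevel X j = [::] -> ulevel X i = [::].
Proof.
move=> le_ij one_below level_j; rewrite -(subKn le_ij).
have := @interlaces_nil_chain _ _ gtn_strict_total (fun l => ulevel X (j - l)) (j - i).
apply=> //; first by rewrite subn0.
by move=> l lt_l; have := one_below (j - l.+1); rewrite subnSK => [->|] //; lia.
Qed.

Lemma schedules_odd_size : X != [::] -> schedules odd s X -> size (ulevel X s) = 1.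
Proof.
move=> Xn0 odd_X; have [one_below le1 one_above _] := schedules_odd_levels odd_X.
apply/eqP; rewrite eqn_leq le1 lt0n size_eq0; apply/eqP => level_s.
have level_nil i : ulevel X i = [::].
  by have [/ulevel_nil_above|/ltnW/ulevel_nil_below] := leqP s i; apply.
have /hasP[c cX _] : has predT X by rewrite has_predT lt0n size_eq0.
have /schedulesP[_ _ _ /(_ c cX)] := odd_X; rewrite /crossings !level_nil.
have [c_dec /(_ isT)//|cU _] := boolP (decorated c).
have : label c \in ulevel X (level c) by apply/ulevelP; exists c.
by rewrite level_nil.
Qed.

Lemma schedules_odd_one : X != [::] -> schedules odd s X -> schedules (pred1 1) s X.
Proof.
move=> Xn0 odd_X; have [one_below le1 one_above le2] := schedules_odd_levels odd_X.
have /schedulesP[_ _ _ odd_dec] := odd_X.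
apply/schedulesP; split=> // [|c cX c_dec].
  case: (ulevel X s) (schedules_odd_size Xn0 odd_X) => [|v []] // _.
  by rewrite /= ltnn.
suff le2_c : crossings gtn (ulevel X (level c)) (ulevel X (level c).+1) (label c) <= 2.
  by have := odd_dec c cX c_dec; rewrite /=; lia.
have [lt_c_s|le_s_c] := ltnP (level c) s.
  by apply: (crossings_le2 gtn_strict_total) => //; apply: one_below.
rewrite -[crossings _ _ _ _]crossings_converse.
by apply: (crossings_le2 ltn_strict_total) => //; apply: one_above.
Qed.

End Levels.

(* Between the levels [s] and [s'] no level is empty, so that interlacing upwards
   and interlacing downwards are equivalent there. *)
Lemma schedules_one_shift s s' X : X != [::] -> uniq (map label X) ->
  schedules (pred1 1) s X -> size (ulevel X s') = 1 -> schedules (pred1 1) s' X.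
Proof.
move=> Xn0 uniqX one_X size_s'; have uniq_ulevel i := ulevel_uniq i uniqX.
have odd_X := schedules_one_odd one_X.
have [_ _ _ le2] := schedules_odd_levels uniqX odd_X.
have size_s := schedules_odd_size uniqX Xn0 odd_X.
have /schedulesP[one_below one_at one_above one_dec] := one_X.
have gt0_above i : s <= i <= s' -> 0 < size (ulevel X i) <= 2.
  rewrite le2 andbT lt0n size_eq0 => /andP[le_si le_is']; apply/eqP.
  move=> /(ulevel_nil_above uniqX le_is') level_s'.
  by rewrite level_s' // in size_s' => l le_il; apply/one_above/(leq_trans le_si).
have gt0_below i : s' <= i <= s -> 0 < size (ulevel X i) <= 2.
  rewrite le2 andbT lt0n size_eq0 => /andP[le_s'i le_is]; apply/eqP.
  move=> /(ulevel_nil_below uniqX le_s'i) level_s'.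
  by rewrite level_s' // in size_s' => l lt_li; apply/one_below/(leq_trans lt_li).
apply/schedulesP; split=> // [i lt_is'||i le_s'i].
- have [le_si|/one_below//] := leqP s i.
  by apply: (interlaces_converse ltn_strict_total); rewrite ?gt0_above ?one_above //; lia.
- by case: (ulevel X s') size_s' => [|v []] //= _; rewrite ltnn.
- have [/one_above//|lt_is] := leqP s i.
  by apply: (interlaces_converse gtn_strict_total); rewrite ?gt0_below ?one_below //; lia.
Qed.

(** * Signed sums over words *)

Lemma prod_natb (T : Type) (a : pred T) (X : seq T) :
  (\prod_(c <- X) (a c)%:R = (all a X)%:R :> int)%R.
Proof.
by elim: X => [|c X IH]; rewrite ?big_nil // big_cons IH -natrM mulnb.
Qed.

Definition sign_exponent (s : nat) (u : seq letter) : nat :=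
  nattacks u + count (fun c => level c < s) u + count decorated u.

Definition nundecorated_below (s : nat) (X : seq letter) : nat :=
  count (fun c => ~~ decorated c && (level c < s)) X.

Lemma nundecorated_below0 X : nundecorated_below 0 X = 0.
Proof. by apply: hasN_count; apply/hasPn => c _; rewrite ltn0 andbF. Qed.

Lemma nundecorated_belowS s X :
  nundecorated_below s.+1 X = nundecorated_below s X + size (ulevel X s).
Proof.
rewrite /nundecorated_below /ulevel size_map size_filter.
by elim: X => [|c X IH] //=; case: (decorated c) => /=; lia.
Qed.

Lemma nundecorated_below_all L X : all (fun c => level c < L) X ->
  nundecorated_below L X = count (predC decorated) X.
Proof. by move=> /allP ltXL; apply: eq_in_count => c /ltXL->; rewrite andbT. Qed.

Section SignedSums.
Variables (N : nat) (X : seq letter).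
Hypotheses (Xn0 : X != [::]) (uniqX : uniq (map label X)) (ltXN : labels_lt N X).
Local Open Scope ring_scope.

Definition signed_sum (s : nat) : int :=
  \sum_(u <- permutations X | valid N s u) (-1) ^+ sign_exponent s u.

Lemma signed_sumE s :
  signed_sum s = (-1) ^+ nundecorated_below s X * (schedules odd s X)%:R.
Proof.
pose m := (count (fun c => (level c < s)%N) X + count decorated X)%N.
have -> : signed_sum s = (-1) ^+ m * attack_sum (-1 : int) N s X.
  rewrite /signed_sum mulr_sumr big_seq_cond [RHS]big_seq_cond; apply: eq_bigr => u.
  rewrite mem_permutations => /andP[/permP permu _].
  by rewrite /sign_exponent !permu -exprD -addnA addnC.
rewrite schedule_formula // /schedule_prod.
rewrite (eq_bigr _ (fun c _ => qintN1 _)) prod_natb mulrA -exprD; congr (_ * _).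
rewrite -signr_odd -[RHS]signr_odd; congr (_ ^+ _); congr nat_of_bool.
rewrite /m /nundecorated_below; elim: X => [|c Y IH] //=.
by case: (decorated c) => /=; case: (leqP s (level c)) => /=; lia.
Qed.

(* The sum telescopes, because a level with one undecorated letter changes the parity of
   the number of undecorated letters below, and a level with none or two does not. *)
Lemma sum_signed_levels L : (forall i, size (ulevel X i) <= 2)%N ->
  \sum_(0 <= s < L) (-1) ^+ nundecorated_below s X * (size (ulevel X s) == 1%N)%:R
  = (odd (nundecorated_below L X))%:R :> int.
Proof.
move=> le2; pose parity s := (odd (nundecorated_below s X))%:R : int.
transitivity (parity L - parity 0%N).
  rewrite -(telescope_sumr parity (leq0n L)) /parity.
  apply: eq_bigr => s _; rewrite nundecorated_belowS -signr_odd oddD.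
  by case: (size _) (le2 s) => [|[|[|]]] //= _; case: (odd (nundecorated_below s X)).
by rewrite /parity nundecorated_below0 subr0.
Qed.

Lemma sum_signed_one L s0 :
  all (fun c => level c < L)%N X -> schedules (pred1 1%N) s0 X ->
  \sum_(0 <= s < L) signed_sum s = (odd (count (predC decorated) X))%:R.
Proof.
move=> ltXL one_X; have odd_X := schedules_one_odd one_X.
have [_ _ _ le2] := schedules_odd_levels uniqX odd_X.
rewrite -(nundecorated_below_all ltXL) -sum_signed_levels //; apply: eq_bigr => s _.
rewrite signed_sumE; congr (_ * _%:R); congr nat_of_bool.
apply/idP/eqP => [/(schedules_odd_size uniqX Xn0)//|size_s].
exact: schedules_one_odd (schedules_one_shift Xn0 uniqX one_X size_s).
Qed.

Lemma sum_signed_not_one L : (forall s, ~~ schedules (pred1 1%N) s X) ->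
  \sum_(0 <= s < L) signed_sum s = 0.
Proof.
move=> not_one; apply: big1 => s _; rewrite signed_sumE.
have [/(schedules_odd_one uniqX Xn0) one_X|_] := boolP (schedules odd s X); last first.
  by rewrite mulr0.
by have := not_one s; rewrite one_X.
Qed.

Lemma count_valid s : (count (valid N s) (permutations X))%:R
  = \prod_(c <- X) (schedule s X c)%:R :> int.
Proof.
have := schedule_formula (1 : int) s uniqX ltXN.
rewrite /schedule_prod expr1n mul1r (eq_bigr _ (fun c _ => qint1 _)) => <-.
by rewrite -sum1_count natr_sum; apply: eq_bigr => u _; rewrite expr1n.
Qed.

Lemma count_valid_one s : schedules (pred1 1%N) s X ->
  count (valid N s) (permutations X) = 1%N.
Proof.
move=> /allP one_X; have := count_valid s.
rewrite big_seq big1 => [/eqP|c /one_X/eqP->//].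
by rewrite (@eqr_nat int _ 1) => /eqP.
Qed.

Lemma valid_exists s : schedules (pred1 1%N) s X -> exists2 u, perm_eq u X & valid N s u.
Proof.
move=> one_X; have : has (valid N s) (permutations X).
  by rewrite has_count count_valid_one.
by case/hasP=> u; rewrite mem_permutations; exists u.
Qed.

Lemma valid_unique s u v : schedules (pred1 1%N) s X -> perm_eq u X -> perm_eq v X ->
  valid N s u -> valid N s v -> u = v.
Proof.
move=> one_X permu permv u_valid v_valid.
have mem_valid w : perm_eq w X -> valid N s w ->
    w \in filter (valid N s) (permutations X).
  by move=> permw w_valid; rewrite mem_filter w_valid mem_permutations.
have := mem_valid v permv v_valid; have := mem_valid u permu u_valid.
have := count_valid_one one_X; rewrite -size_filter.
by case: filter => [|w []] //; rewrite !inE => _ /eqP-> /eqP->.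
Qed.

End SignedSums.

(** * Cutting words *)

Lemma valid_cons N s x u : labels_lt N (x :: u) ->
  valid N s (x :: u) =
  [&& (level x < s) || ((level x == s) && ~~ decorated x), path follows x u
    & s <= level (last x u)].
Proof.
move=> /allP ltN; rewrite /valid /= rcons_path marker_follows ?follows_marker //.
  exact: ltN (mem_last x u).
exact: ltN (mem_head x u).
Qed.

Lemma valid_widen N M s u : labels_lt N u -> N <= M -> valid M s u = valid N s u.
Proof.
case: u => [|x u] ltN leNM; first by rewrite /valid /= /follows /= eqxx !leqnn.
by rewrite !valid_cons //; apply: sub_all ltN => d /leq_trans; apply.
Qed.

Lemma labels_lt_widen N M u : labels_lt N u -> N <= M -> labels_lt M u.
Proof. by move=> ltuN leNM; apply: sub_all ltuN => d /leq_trans; apply. Qed.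

Lemma insertable_marker N s s' u : labels_lt N u -> all (insertable s (marker N s')) u.
Proof. by apply: sub_all => d; rewrite /insertable ltn_neqAle => /andP[->]. Qed.

Lemma valid_insert_marker N s s' u :
  labels_lt N u -> valid N s u -> 0 < size (ulevel u s') ->
  exists j, valid N.+1 s (insert j (marker N s') u).
Proof.
move=> ltuN u_valid level_s'; have ltuN1 := labels_lt_widen ltuN (leqnSn N).
have u_valid1 : valid N.+1 s u by rewrite (valid_widen s ltuN).
have := insertion_sum_schedule (1 : int)%R (ltnSn N : label (marker N s') < N.+1)
  ltuN1 (insertable_marker s s' ltuN) u_valid1.
have schedule_gt0 : 0 < schedule s u (marker N s').
  rewrite /schedule orbT addn_gt0; apply/orP; left; rewrite -has_count.
  case E: (ulevel u s') level_s' => [|v l] // _.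
  apply/hasP; exists v; first exact: mem_head.
  have /ulevelP[d [du _ _ <-]] : v \in ulevel u s' by rewrite E mem_head.
  exact: (allP ltuN).
have [/hasP[j _ j_valid] _|/hasPn none] :=
    boolP (has (fun j => valid N.+1 s (insert j (marker N s') u)) (iota 0 (size u).+1)).
  by exists j.
rewrite big1_seq => [/esym/eqP|j /andP[]]; last first.
  by rewrite /index_iota subn0 => j_valid /none; rewrite j_valid.
by rewrite qint1 !expr1n !mul1r pnatr_eq0 eqn0Ngt schedule_gt0.
Qed.

(* A second marker, of level [s'], is inserted as a decorated letter, and the first one is
   removed. *)
Lemma valid_cut N s s' u : labels_lt N u -> valid N s u -> 0 < size (ulevel u s') ->
  exists u1 u2, [/\ u = u1 ++ u2, valid N s' (u2 ++ u1),
    s' <= level (last (marker N s) u1) & level (head (marker N s) u2) <= s'].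
Proof.
move=> ltuN u_valid level_s'.
have [j j_valid] := valid_insert_marker ltuN u_valid level_s'.
exists (take j u), (drop j u).
have ltuN1 := labels_lt_widen ltuN (leqnSn N).
have rotate_valid : valid N s' (drop j u ++ take j u).
  move: j_valid; rewrite /valid -(rot_cycle (size (marker N.+1 s :: take j u))).
  rewrite /insert -[_ :: take _ _ ++ _]cat_cons rot_size_cat -cat_cons.
  by apply: cycle_remove => p x; apply: follows_trans_decorated.
have /and3P[_ follows_last follows_head] : [&& valid N.+1 s u,
    follows (last (marker N.+1 s) (take j u)) (marker N s')
  & follows (marker N s') (head (marker N.+1 s) (drop j u))].
  by rewrite -valid_insert ?j_valid ?ltnSn ?insertable_marker.
split=> //; first by rewrite cat_take_drop.
  move: follows_last; rewrite /follows /=.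
  by case: (take j u) => [|x w] /=; rewrite /level /=; lia.
move: follows_head; have : labels_lt N (drop j u).
  by apply/allP => d /mem_drop/(allP ltuN).
case: (drop j u) => [_|x w /andP[ltxN _]] /=; first by rewrite /follows /level /=; lia.
by rewrite marker_follows // /level /=; lia.
Qed.

(** * The word of a path *)

Fixpoint heights (h : int) (P : lpath) : seq (int * (nat * bool)) :=
  match P with
  | [::] => [::]
  | None :: P' => heights (h - 1)%R P'
  | Some x :: P' => (h, x) :: heights (h + 1)%R P'
  end.

Lemma north_pos_cons x P :
  north_pos (x :: P) = (if is_north x then [:: 0] else [::]) ++ map succn (north_pos P).
Proof.
rewrite /north_pos /= -[1]/(1 + 0) iotaDl filter_map.
by case: (is_north x).
Qed.

Lemma columns_cons x P : columns (x :: P) =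
  (if is_north x then [:: 0] else [::]) ++ map (addn (is_east x)) (columns P).
Proof.
by rewrite /columns north_pos_cons map_cat -!map_comp; case: (is_north x).
Qed.

Lemma area_word_cons x P : area_word (x :: P) =
  (if is_north x then [:: 0%R] else [::])
  ++ map (fun a => a + (if is_north x then 1 else -1))%R (area_word P).
Proof.
rewrite /area_word north_pos_cons map_cat -!map_comp; congr (_ ++ _).
  by case: (is_north x).
apply: eq_map => m /=; rewrite /ycoord /xcoord /= /is_east /is_north.
by case: x => [y|] /=; lia.
Qed.

Lemma heights_shift h P : heights h P = [seq ((v.1 + h)%R, v.2) | v <- heights 0%R P].
Proof.
elim: P h => [|[x|] P IH] h //=; rewrite (IH (_ + _)%R) [in RHS]IH -map_comp.
  rewrite add0r; congr (_ :: _); apply: eq_map => v /=.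
  by congr (_, _); lia.
by apply: eq_map => v /=; congr (_, _); lia.
Qed.

Lemma area_wordE P : area_word P = map fst (heights 0%R P).
Proof.
elim: P => [|x P IH] //; rewrite area_word_cons IH.
by case: x => [x|] /=; rewrite [in RHS]heights_shift -!map_comp ?add0r.
Qed.

Lemma lettersE P : letters P = map snd (heights 0%R P).
Proof.
elim: P => [|x P IH] //; case: x => [x|] /=; rewrite heights_shift -map_comp;
  by rewrite [LHS]/= -/(letters P) IH.
Qed.

Lemma zip_area_word_letters P : zip (area_word P) (letters P) = heights 0%R P.
Proof. by rewrite area_wordE lettersE zip_unzip. Qed.

Definition word (P : lpath) : seq letter :=
  [seq (absz (v.1 + (shift P)%:Z)%R, v.2) | v <- heights 0%R P].

Lemma size_heights h P : size (heights h P) = nb_north P.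
Proof. by elim: P h => [|[x|] P IH] h //=; rewrite IH. Qed.

Lemma size_word P : size (word P) = nb_north P.
Proof. by rewrite size_map size_heights. Qed.

Lemma size_area_word P : size (area_word P) = nb_north P.
Proof. by rewrite area_wordE size_map size_heights. Qed.

Lemma size_letters P : size (letters P) = nb_north P.
Proof. by rewrite lettersE size_map size_heights. Qed.

Lemma size_columns P : size (columns P) = nb_north P.
Proof. by rewrite -size_area_word !size_map. Qed.

Lemma labels_word P : labels P = map label (word P).
Proof. by rewrite /labels lettersE -!map_comp. Qed.

Lemma decs_word P : decs P = map decorated (word P).
Proof. by rewrite /decs lettersE -!map_comp. Qed.

Lemma nb_dec_word P : nb_dec P = count decorated (word P).
Proof. by rewrite /nb_dec decs_word count_map. Qed.

Lemma aw_col P i : i < nb_north P -> aw P i = (i%:Z - (col P i)%:Z)%R.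
Proof.
rewrite /aw /col; elim: P i => [|x P IH] i //; rewrite area_word_cons columns_cons.
case: x => [x|] /=; rewrite /nb_north /= -/(nb_north P) ?add1n ?add0n => lti.
  case: i lti => [|i] lti /=; first by rewrite subrr.
  by rewrite (nth_map 0%R) ?size_area_word // IH // (nth_map 0) ?size_columns //; lia.
by rewrite (nth_map 0%R) ?size_area_word // IH // (nth_map 0) ?size_columns //; lia.
Qed.

Lemma columns_sorted P : sorted leq (columns P).
Proof.
elim: P => [|x P IH] //; rewrite columns_cons.
have : sorted leq (map (addn (is_east x)) (columns P)).
  by rewrite sorted_map; apply: sub_sorted IH => a b /=; rewrite leq_add2l.
by case: x => [x|] //=; case: map => //= *; apply/andP.
Qed.

Lemma leq_col P i j : i <= j < nb_north P -> col P i <= col P j.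
Proof.
move=> /andP[leij ltj].
apply: (sorted_leq_nth leq_trans leqnn 0 (columns_sorted P)) => //;
  by rewrite inE size_columns // (leq_ltn_trans leij).
Qed.

Lemma shiftP P : 0 < nb_north P ->
  (- (shift P)%:Z)%R \in area_word P
  /\ {in area_word P, forall a, (0 <= a + (shift P)%:Z)%R}.
Proof.
move=> P_gt0; have aw0_le0 : (aw P 0 <= 0)%R by rewrite aw_col //; lia.
have aw0_in : aw P 0 \in area_word P by rewrite mem_nth ?size_area_word.
rewrite /shift; set m := \big[_/_]_(_ <- _) _.
have m_le_aw0 : (m <= aw P 0)%R by apply: bigmin_le_id.
have -> : ((absz (- m))%:Z = - m)%R by lia.
rewrite opprK; split; last first.
  by move=> a a_in; rewrite subr_ge0; apply: ge_bigmin_seq.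
rewrite /m big_seq; elim/big_ind: _ => // x y x_in y_in.
by rewrite minEle; case: ifP.
Qed.

Definition letter0 : letter := (0, (0, false)).

Lemma level_word P i : i < nb_north P ->
  ((level (nth letter0 (word P) i))%:Z = aw P i + (shift P)%:Z)%R.
Proof.
move=> lti; rewrite (nth_map (0%R, (0, false))) ?size_heights // /level /=.
have [|_ ge0] := @shiftP P; first exact: leq_ltn_trans lti.
rewrite -(nth_map _ 0%R fst) ?size_heights // -area_wordE gez0_abs //.
by apply: ge0; rewrite mem_nth ?size_area_word.
Qed.

Lemma label_word P i : i < nb_north P -> label (nth letter0 (word P) i) = lab P i.
Proof. by move=> lti; rewrite /lab labels_word (nth_map letter0) ?size_word. Qed.

Lemma decorated_word P i : i < nb_north P -> decorated (nth letter0 (word P) i) = dec P i.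
Proof. by move=> lti; rewrite /dec decs_word (nth_map letter0) ?size_word. Qed.

Lemma area_word_levels P : 0 < nb_north P ->
  area_word P = [seq ((level x)%:Z - (shift P)%:Z)%R | x <- word P].
Proof.
move=> P_gt0; apply: (@eq_from_nth _ 0%R) => [|i].
  by rewrite [RHS]size_map size_word size_area_word.
rewrite size_area_word => lti.
by rewrite (nth_map letter0) ?size_word // level_word // addrK.
Qed.

Lemma area_levels P : 0 < nb_north P -> area P = sumn (map level (word P)).
Proof.
move=> P_gt0; rewrite /area {1}area_word_levels // big_map.
under eq_bigr do rewrite subrK.
by rewrite -(big_morph Posz PoszD (erefl _)) sumnE big_map.
Qed.

Lemma count_negative_area_word P : 0 < nb_north P ->
  count (fun a : int => (a < 0)%R) (area_word P)
  = count (fun x => level x < shift P) (word P).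
Proof.
move=> P_gt0; rewrite {1}area_word_levels // count_map; apply: eq_count => x /=.
by lia.
Qed.

Lemma nattacks_sum u : nattacks u =
  \sum_(0 <= i < size u) \sum_(0 <= j < size u)
     ((i < j) && attacks (nth letter0 u i) (nth letter0 u j)).
Proof.
elim: u => [|x u IH]; first by rewrite big_geq.
rewrite /= big_nat_recl // big_nat_recl //= add0n; congr (_ + _).
  rewrite -sum1_count (big_nth letter0) big_mkcond.
  by apply: eq_bigr => j _; case: attacks.
by rewrite IH; apply: eq_bigr => i _; rewrite big_nat_recl //= add0n.
Qed.

Lemma nb_attack_word P : nb_attack P = nattacks (word P).
Proof.
rewrite /nb_attack cardsE -sum1_card big_mkcond /=.
rewrite -(pair_bigA _ (fun i j : 'I_(nb_north P) => if attack P i j then 1 else 0)) /=.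
rewrite nattacks_sum size_word big_mkord; apply: eq_bigr => i _.
rewrite big_mkord; apply: eq_bigr => j _.
have := @level_word P i (ltn_ord i); have := @level_word P j (ltn_ord j).
rewrite /attack /attacks !label_word // !decorated_word //.
case: (dec P i) => /=; rewrite ?andbF //; case: ltnP => //= _ level_j level_i.
by case: ifP; lia.
Qed.

Lemma sign_dinv P : 0 < nb_north P ->
  ((-1 : int) ^ dinv P = (-1) ^+ sign_exponent (shift P) (word P))%R.
Proof.
move=> P_gt0; rewrite /dinv nb_attack_word count_negative_area_word // nb_dec_word.
rewrite /sign_exponent -PoszD; set a := (_ + _)%N; set b := count _ _.
rewrite expN1r -signr_odd -[RHS]signr_odd; congr (_ ^+ _)%R; congr nat_of_bool.
by lia.
Qed.

(** * Decorated labeled square paths and valid words *)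

Lemma nb_east_north P : count is_east P + nb_north P = size P.
Proof. by rewrite addnC -(count_predC is_north P). Qed.

Lemma square_path_north n P : square_path n P -> nb_north P = n.
Proof. by case/and3P=> _ /eqP. Qed.

Lemma square_path_east n P : square_path n P -> count is_east P = n.
Proof. by case/and3P=> /eqP sizeP /eqP northP _; have := nb_east_north P; lia. Qed.

Lemma col_lt_east P i :
  is_east (last None P) -> i < nb_north P -> col P i < count is_east P.
Proof.
move=> last_east lti; have ltin : i < size (north_pos P).
  by rewrite -(size_map (xcoord P)) size_columns.
rewrite /col (nth_map 0) //.
have := mem_nth 0 ltin; set m := nth _ _ _.
rewrite mem_filter mem_iota => /andP[m_north ltmP].
case/lastP: P last_east {lti ltin} @m m_north ltmP => // P [x|].
  by rewrite last_rcons.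
move=> _ m.
rewrite nth_rcons size_rcons ltnS /xcoord -cats1 take_cat count_cat addn1 ltnS.
case: ltngtP => // ltmP _ _.
by rewrite -[X in _ <= count _ X](cat_take_drop m P) count_cat leq_addr.
Qed.

Lemma shift_lt n P : 0 < n -> square_path n P -> shift P < n.
Proof.
move=> n_gt0 squareP; have northP := square_path_north squareP.
have [|/(nthP 0%R)[j] + shiftE _] := @shiftP P; first by rewrite northP.
rewrite size_area_word => ltj; rewrite -/(aw P j) aw_col // in shiftE.
have lt_col : col P j < n.
  by rewrite -[X in _ < X](square_path_east squareP) col_lt_east //; case/and3P: squareP.
by lia.
Qed.

Lemma level_lt n P : 0 < n -> square_path n P -> all (fun x => level x < n + n) (word P).
Proof.
move=> n_gt0 squareP; have northP := square_path_north squareP.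
apply/(all_nthP letter0) => i; rewrite size_word northP => lti.
have := @level_word P i; rewrite northP => /(_ lti); rewrite aw_col ?northP //.
by have := shift_lt n_gt0 squareP; lia.
Qed.

Lemma column_strictP P :
  reflect (forall i, i.+1 < nb_north P -> col P i = col P i.+1 -> lab P i < lab P i.+1)
    [forall i : 'I_(nb_north P), forall j : 'I_(nb_north P),
       (i < j) && (col P i == col P j) ==> (lab P i < lab P j)].
Proof.
apply: (iffP forallP) => [strict i lti colE|strict i].
  have /forallP/(_ (Ordinal lti)) := strict (Ordinal (ltnW lti)).
  by rewrite /= ltnSn colE eqxx.
apply/forallP => j; apply/implyP => /andP[ltij /eqP colE].
pose lex i j := (col P i < col P j) || (col P i == col P j) && (lab P i < lab P j).
suff : lex i j by rewrite /lex colE ltnn eqxx.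
have lex_trans : transitive lex by move=> l m p; rewrite /lex; lia.
apply: (homo_ltn_in (D := [pred l | l < nb_north P]) (f := id) (r := lex)) => //=.
- by move=> l m _ ltm p /andP[_ /ltn_trans]; apply.
- move=> l _; rewrite inE => ltl; rewrite /lex.
  have := @leq_col P l l.+1; rewrite leqnSn ltl => /(_ isT).
  by have := strict l ltl; case: (ltngtP (col P l)) => // colSE /(_ colSE)->.
- exact: ltn_ord.
- exact: ltn_ord.
Qed.

Section ValidWord.
Variables (n N : nat) (P : lpath).
Hypotheses (n_gt0 : 0 < n) (squareP : square_path n P).
Hypothesis ltPN : labels_lt N (word P).

Let northP : nb_north P = n. Proof. exact: square_path_north squareP. Qed.
Let level_col i : i < n ->
  ((level (nth letter0 (word P) i))%:Z = i%:Z - (col P i)%:Z + (shift P)%:Z)%R.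
Proof. by move=> lti; rewrite level_word ?aw_col ?northP. Qed.

Lemma word_neq_nil : word P != [::].
Proof. by rewrite -size_eq0 size_word northP -lt0n. Qed.

Lemma marker_follows_head_word :
  follows (marker N (shift P)) (nth letter0 (word P) 0) = (dec P 0 ==> contractible P 0).
Proof.
rewrite marker_follows; last by rewrite (allP ltPN) // mem_nth // size_word northP.
have := level_col n_gt0.
rewrite decorated_word ?northP // /contractible aw_col ?northP //.
by case: (dec P 0); lia.
Qed.

Lemma last_word_follows_marker :
  follows (nth letter0 (word P) n.-1) (marker N (shift P)).
Proof.
have ltn1 : n.-1 < n by rewrite prednK.
rewrite follows_marker; last by rewrite (allP ltPN) // mem_nth // size_word northP.
have := level_col ltn1; have := @col_lt_east P n.-1.
have /and3P[_ _ last_east] := squareP.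
by rewrite northP (square_path_east squareP) => /(_ last_east ltn1); lia.
Qed.

Hypothesis uniqP : uniq (labels P).

Lemma follows_nth_word i : i.+1 < n ->
  follows (nth letter0 (word P) i) (nth letter0 (word P) i.+1) =
  ((col P i == col P i.+1) ==> (lab P i < lab P i.+1))
  && (dec P i.+1 ==> contractible P i.+1).
Proof.
move=> ltSi; have lti := ltnW ltSi.
have := level_col ltSi; have := level_col lti.
have : col P i <= col P i.+1 by rewrite leq_col // leqnSn northP.
have : lab P i != lab P i.+1.
  by rewrite /lab nth_uniq ?size_map ?size_letters ?northP // neq_ltn ltnSn.
rewrite /follows !label_word ?decorated_word ?northP //= !aw_col ?northP //.
by case: (dec P i.+1) => /=; lia.
Qed.

Lemma valid_wordP :
  reflect ((forall i, i.+1 < n -> col P i = col P i.+1 -> lab P i < lab P i.+1)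
           /\ forall i, i < n -> dec P i -> contractible P i)
    (valid N (shift P) (word P)).
Proof.
have -> : valid N (shift P) (word P) =
    follows (marker N (shift P)) (nth letter0 (word P) 0) && sorted follows (word P).
  have := last_word_follows_marker; rewrite -northP -size_word nth_last /valid.
  by case: (word P) word_neq_nil => //= x u _ xm; rewrite rcons_path xm andbT.
rewrite marker_follows_head_word.
apply: (iffP andP) => [[dec0 /(sortedP letter0)]|[strict contr]].
  rewrite size_word northP => sorted_word; split=> [i ltSi|[|i] lti].
  - move=> colE; have := sorted_word i ltSi; rewrite follows_nth_word // => /andP[+ _].
    by rewrite colE eqxx.
  - exact/implyP.
  - by have := sorted_word i lti; rewrite follows_nth_word // => /andP[_ /implyP].
split; first exact/implyP/contr.
apply/(sortedP letter0) => i; rewrite size_word northP => ltSi.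
rewrite follows_nth_word //; apply/andP; split; last exact/implyP/contr.
by apply/implyP => /eqP; apply: strict.
Qed.

Lemma LSQ_word (k : nat) :
  LSQ n k P = [&& all (fun c => 0 < c) (labels P), valid N (shift P) (word P)
                & count decorated (word P) == k].
Proof.
rewrite /LSQ squareP /labeling nb_dec_word /= -!andbA; congr (_ && _).
rewrite andbA; congr (_ && _); apply/andP/valid_wordP => [[]|[]].
  move=> /column_strictP strict /forallP contr; split=> i; rewrite -northP => lti.
    exact: strict.
  exact/implyP/(contr (Ordinal lti)).
rewrite -northP => strict contr; split; first exact/column_strictP.
by apply/forallP => i; apply/implyP/contr.
Qed.

End ValidWord.

(** * The path of a word *)

(* The path from height [h] to height [f] with word [u].  A letter too high to be reached
   is placed without any east step, by truncated subtraction. *)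
Fixpoint build_path (f h : nat) (u : seq letter) : lpath :=
  if u is x :: u' then
    nseq (h - level x) None ++ Some x.2 :: build_path f (level x).+1 u'
  else nseq (h - f) None.

Fixpoint fits (h : nat) (u : seq letter) : bool :=
  if u is x :: u' then (level x <= h) && fits (level x).+1 u' else true.

Definition end_height (h : nat) (u : seq letter) : nat :=
  last h [seq (level x).+1 | x <- u].

Lemma build_path_cat f g h u1 u2 : g <= end_height h u1 ->
  (if u2 is x :: _ then level x <= g else f <= g) ->
  build_path f h (u1 ++ u2) = build_path g h u1 ++ build_path f g u2.
Proof.
rewrite /end_height; elim: u1 h => [|x u1 IH] h /= le_g le_g2; last first.
  by rewrite IH // -catA.
case: u2 le_g2 => [|y u2] le_g2 /=; rewrite ?catA -nseqD; first by congr nseq; lia.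
by congr (nseq _ _ ++ _); lia.
Qed.

Lemma heights_nseq_east h m Q : heights h (nseq m None ++ Q) = heights (h - m%:Z)%R Q.
Proof.
elim: m h => [|m IH] h /=; first by rewrite subr0.
by rewrite IH; congr heights; lia.
Qed.

Lemma heights_build_path s f h u : fits h u ->
  heights (h%:Z - s%:Z)%R (build_path f h u)
  = [seq (((level x)%:Z - s%:Z)%R, x.2) | x <- u].
Proof.
elim: u h => [|x u IH] h /=; first by rewrite -[nseq _ _]cats0 heights_nseq_east.
move=> /andP[le_xh fits_u]; rewrite heights_nseq_east /= -(IH (level x).+1) //.
by congr ((_, _) :: heights _ _); lia.
Qed.

Lemma nb_north_build_path f h u : nb_north (build_path f h u) = size u.
Proof.
elim: u h => [|x u IH] h; rewrite /nb_north /= ?count_cat count_nseq //=.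
by rewrite -/(nb_north _) IH.
Qed.

Lemma size_build_path f h u : fits h u -> f <= end_height h u ->
  size (build_path f h u) + f = size u + size u + h.
Proof.
rewrite /end_height; elim: u h => [|x u IH] h /=; first by rewrite size_nseq; lia.
move=> /andP[le_xh fits_u] le_f; rewrite size_cat size_nseq /=.
by have := IH _ fits_u le_f; lia.
Qed.

Lemma last_build_path z f h u : f < end_height h u -> last z (build_path f h u) = None.
Proof.
rewrite /end_height; elim: u h z => [|x u IH] h z /= lt_f; last by rewrite last_cat /= IH.
by rewrite -[h - f]prednK ?subn_gt0 //=; elim: (_.-1).
Qed.

Lemma valid_fits N s u : u != [::] -> labels_lt N u -> valid N s u ->
  fits s u && (s < end_height s u).
Proof.
case: u => // x u _ ltuN; rewrite valid_cons // => /and3P[x_first u_path x_last].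
apply/andP; split; last by rewrite /end_height /= (last_map (fun x => (level x).+1)) ltnS.
rewrite /=; apply/andP; split; first by lia.
elim: u x {x_first ltuN x_last} u_path => [|y u IH] x //= /andP[xy /IH->]; rewrite andbT.
by move: xy; rewrite /follows; case: (decorated y); lia.
Qed.

Lemma heights_head_le h P :
  if heights h P is v :: _ then (v.1 <= h)%R else nb_north P = 0 :> nat.
Proof.
elim: P h => [|[x|] P IH] h //=.
by have := IH (h - 1)%R; case: (heights _ _) => [|v l] //=; lia.
Qed.

Lemma build_path_heights P (h f s : nat) :
  all (fun v : int * (nat * bool) => 0 <= v.1 + s%:Z)%R (heights (h%:Z - s%:Z)%R P) ->
  f + count is_east P = h + nb_north P ->
  build_path f h [seq (absz (v.1 + s%:Z)%R, v.2) | v <- heights (h%:Z - s%:Z)%R P] = P.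
Proof.
elim: P h => [|[x|] P IH] h /=.
- by rewrite /nb_north /= => _ endE; rewrite (_ : h - f = 0) //; lia.
- rewrite subrK => /andP[_]; rewrite /nb_north /= subnn /=.
  rewrite (_ : (h%:Z - s%:Z + 1 = h.+1%:Z - s%:Z)%R); last lia.
  by move=> ge0 endE; rewrite IH // /nb_north; lia.
rewrite /nb_north /= => ge0 endE; have := heights_head_le (h%:Z - s%:Z - 1)%R P.
have h_gt0 : 0 < h.
  have := heights_head_le (h%:Z - s%:Z - 1)%R P; rewrite /nb_north.
  by case: (heights _ _) ge0 => [|v l] /=; lia.
case: h h_gt0 ge0 endE => // h _.
rewrite (_ : (h.+1%:Z - s%:Z - 1 = h%:Z - s%:Z)%R); last lia.
move=> ge0 endE head_le; rewrite -[in RHS](IH h ge0); last by rewrite /nb_north; lia.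
case: (heights _ _) ge0 head_le => [|v l] /=.
  by rewrite /nb_north => _ north0; rewrite (_ : h.+1 - f = (h - f).+1) //; lia.
rewrite /level /= => /andP[v_ge0 _] v_le.
by rewrite (_ : h.+1 - _ = (h - absz (v.1 + s%:Z)%R).+1) //; lia.
Qed.

Lemma build_path_word n P : 0 < n -> square_path n P ->
  build_path (shift P) (shift P) (word P) = P.
Proof.
move=> n_gt0 squareP; have northP := square_path_north squareP.
rewrite /word -(subrr (shift P)%:Z%R); apply: build_path_heights; last first.
  by rewrite northP (square_path_east squareP).
rewrite subrr; apply/allP => v v_in; have [|_ ge0] := @shiftP P; first by rewrite northP.
by apply: ge0; rewrite area_wordE map_f.
Qed.

Lemma shift_unique P (s : nat) : 0 < nb_north P ->
  (- s%:Z)%R \in area_word P -> {in area_word P, forall a, (0 <= a + s%:Z)%R} ->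
  shift P = s.
Proof.
move=> P_gt0 s_in s_ge0; have [shift_in shift_ge0] := shiftP P_gt0.
by have := shift_ge0 _ s_in; have := s_ge0 _ shift_in; lia.
Qed.

Lemma word_build_path N n s u : 0 < n -> size u = n -> labels_lt N u ->
  0 \in map level u -> valid N s u ->
  [/\ square_path n (build_path s s u), shift (build_path s s u) = s
    & word (build_path s s u) = u].
Proof.
move=> n_gt0 sizeu ltuN level0 u_valid.
have un0 : u != [::] by rewrite -size_eq0 sizeu -lt0n.
have /andP[fits_u lt_s] := valid_fits un0 ltuN u_valid.
have northE : nb_north (build_path s s u) = n by rewrite nb_north_build_path.
have heightsE : heights 0%R (build_path s s u)
    = [seq (((level x)%:Z - s%:Z)%R, x.2) | x <- u].
  by rewrite -(heights_build_path s s fits_u) subrr.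
have shiftE : shift (build_path s s u) = s.
  apply: shift_unique; rewrite ?northE // area_wordE heightsE -map_comp.
    case/mapP: level0 => x xu level_x; apply/mapP; exists x => //=.
    by rewrite -level_x; lia.
  by move=> a /mapP[x _ ->] /=; lia.
split=> //.
  apply/and3P; split; rewrite ?northE // ?last_build_path //.
  by have := size_build_path fits_u (ltnW lt_s); rewrite sizeu; lia.
rewrite /word heightsE shiftE -map_comp -[RHS]map_id; apply: eq_map => x /=.
by rewrite subrK /=; case: x.
Qed.

(** * Cutting paths *)

Lemma heights_cat h P Q : heights h (P ++ Q) =
  heights h P ++ heights (h + (nb_north P)%:Z - (count is_east P)%:Z)%R Q.
Proof.
elim: P h => [|[x|] P IH] h /=; rewrite ?IH /nb_north /=; [|congr (_ :: _)|];
  by congr (_ ++ heights _ _) || congr heights; lia.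
Qed.

Lemma perm_heights_catC n A B (d := ((nb_north A)%:Z - (count is_east A)%:Z)%R) :
  square_path n (A ++ B) ->
  perm_eq (heights 0%R (B ++ A)) [seq ((v.1 - d)%R, v.2) | v <- heights 0%R (A ++ B)].
Proof.
move=> squareP; have := square_path_north squareP; have := square_path_east squareP.
rewrite /nb_north !count_cat -!/(nb_north _) => eastE northE.
have dE : (0 + (nb_north B)%:Z - (count is_east B)%:Z = - d)%R by rewrite /d; lia.
rewrite !heights_cat dE add0r -/d map_cat perm_catC heights_shift (heights_shift d).
rewrite -map_comp (@eq_map _ _ (_ \o _) id) ?map_id // => v /=.
by rewrite addrK; case: v.
Qed.

Lemma perm_word_catC n A B : 0 < n -> square_path n (A ++ B) ->
  perm_eq (word (B ++ A)) (word (A ++ B)).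
Proof.
move=> n_gt0 squareP; have northP := square_path_north squareP.
have := perm_heights_catC squareP; set d := (_ - _)%R => perm_heights.
have [|shift_in shift_ge0] := @shiftP (A ++ B); first by rewrite northP.
have [|shift_in' shift_ge0'] := @shiftP (B ++ A).
  by move: northP; rewrite /nb_north !count_cat addnC => ->.
have perm_aw : perm_eq (area_word (B ++ A)) [seq (a - d)%R | a <- area_word (A ++ B)].
  by rewrite !area_wordE -map_comp (perm_trans (perm_map fst perm_heights)) // -map_comp.
have shiftE : ((shift (B ++ A))%:Z = (shift (A ++ B))%:Z + d)%R.
  have : (- (shift (A ++ B))%:Z - d)%R \in area_word (B ++ A).
    by rewrite (perm_mem perm_aw) (map_f (fun a => a - d)%R).
  move/shift_ge0'; move: shift_in'; rewrite (perm_mem perm_aw) => /mapP[a /shift_ge0].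
  by lia.
rewrite /word shiftE (perm_trans (perm_map _ perm_heights)) // -map_comp.
set s := shift (A ++ B).
rewrite (@eq_map _ _ (_ \o _) (fun v => (absz (v.1 + s%:Z)%R, v.2))) // => v /=.
by congr (absz _, _); lia.
Qed.

Lemma cut_equiv_perm_word n k P Q : 0 < n -> square_path n P -> cut_equiv n k P Q ->
  perm_eq (word Q) (word P).
Proof.
move=> n_gt0 squareP; rewrite /cut_equiv mem_filter => /andP[_ /mapP[i _ ->]].
rewrite /psi; set m := _.+1; rewrite -[in word P](cat_take_drop m P).
by apply: (perm_word_catC n_gt0); rewrite cat_take_drop.
Qed.

Lemma psi_rot n P m : square_path n P -> 0 < m <= size P -> is_east (nth None P m.-1) ->
  exists2 i, i \in iota 1 n & psi i P = rot m P.
Proof.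
move=> squareP /andP[m_gt0 le_m] m_east; have m_in : m.-1 \in east_pos P.
  by rewrite mem_filter m_east mem_iota /= add0n prednK.
have size_east : size (east_pos P) = n.
  rewrite -(square_path_east squareP) size_filter -[in RHS](mkseq_nth None P) count_map.
  exact: eq_count.
exists (index m.-1 (east_pos P)).+1; last by rewrite /psi /= nth_index // prednK.
by rewrite mem_iota /= add1n ltnS -size_east index_mem.
Qed.

Lemma cut_equiv_cat n k A B : 0 < n -> square_path n (A ++ B) -> LSQ n k (B ++ A) ->
  cut_equiv n k (A ++ B) (B ++ A).
Proof.
move=> n_gt0 squareP lsqQ; rewrite /cut_equiv mem_filter lsqQ /=.
have /and3P[_ _ last_east] : square_path n (B ++ A) by case/and4P: lsqQ.
suff [m [m_bound m_east ->]] : exists m, [/\ 0 < m <= size (A ++ B),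
    is_east (nth None (A ++ B) m.-1) & B ++ A = rot m (A ++ B)].
  by have [i i_in <-] := psi_rot squareP m_bound m_east; apply: map_f.
case: (posnP (size A)) => [/size0nil->|A_gt0] in squareP last_east *.
  exists (size B); rewrite cats0 rot_size nth_last; case/and3P: squareP => /eqP-> _ ->.
  by split=> //; lia.
exists (size A); rewrite rot_size_cat A_gt0 size_cat leq_addr; split=> //.
move: last_east; rewrite last_cat nth_cat prednK // leqnn nth_last.
by case: (A) A_gt0.
Qed.

Lemma cut_equiv_build_path n k N P u1 u2 s' : 0 < n -> square_path n P ->
  labels_lt N (word P) -> valid N (shift P) (word P) -> word P = u1 ++ u2 ->
  s' <= level (last (marker N (shift P)) u1) ->
  level (head (marker N (shift P)) u2) <= s' ->
  LSQ n k (build_path s' s' (u2 ++ u1)) -> cut_equiv n k P (build_path s' s' (u2 ++ u1)).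
Proof.
move=> n_gt0 squareP ltPN P_valid wordE le_last le_head.
set s := shift P in P_valid le_last le_head.
have /andP[fits_word lt_end] := valid_fits (word_neq_nil n_gt0 squareP) ltPN P_valid.
have PE : P = build_path s' s u1 ++ build_path s s' u2.
  rewrite -[LHS](build_path_word n_gt0 squareP) wordE; apply: build_path_cat.
    move: le_last; rewrite /end_height; case: (u1) => //= x v.
    by rewrite (last_map (fun x => (level x).+1)); lia.
  by case: (u2) le_head.
have -> : build_path s' s' (u2 ++ u1) = build_path s s' u2 ++ build_path s' s u1.
  apply: build_path_cat; last first.
    by move: le_last fits_word; rewrite wordE; case: (u1) => [|x v] //= _ /andP[].
  move: lt_end; rewrite wordE /end_height map_cat last_cat.
  case: (u2) le_head => [|x v] //= _.
  by rewrite !(last_map (fun x => (level x).+1)) => /ltnW.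
by rewrite [X in cut_equiv n k X _]PE; apply: cut_equiv_cat; rewrite -?PE.
Qed.

(** * The schedule word of a path *)

Lemma ascent_path i p v :
  path follows p v -> level p <= i -> has (fun y => i < level y) v ->
  exists p' x, [/\ p' \in p :: v, x \in v, follows p' x & level p' <= i < level x].
Proof.
elim: v p => [|y v IH] p //= /andP[py yv] le_pi.
have [lt_iy _|le_yi /= v_above] := ltnP i (level y).
  by exists p, y; rewrite !mem_head le_pi lt_iy py.
have [p' [x [p'_in x_in p'x lt_i]]] := IH y yv le_yi v_above.
by exists p', x; rewrite !in_cons x_in -in_cons p'_in !orbT.
Qed.

(* In a cyclic word the levels increase by steps of one, hence through every level.  The
   marker takes no part in an increase, because it is decorated and its label is large. *)
Lemma ascent_exists N s u i : labels_lt N u -> valid N s u ->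
  has (fun x => level x <= i) u -> has (fun x => i < level x) u ->
  exists p x, [/\ p \in u, x \in u, level p = i, level x = i.+1 & label p < label x].
Proof.
move=> ltuN u_valid /hasP[z zu le_zi] /hasP[y yu lt_iy].
have zm : z \in marker N s :: u by rewrite inE zu orbT.
have [j v rotE] := rot_to zm; move: u_valid; rewrite /valid -(rot_cycle j) rotE.
rewrite /= rcons_path => /andP[v_path _].
have mem_zv w : (w \in z :: v) = (w == marker N s) || (w \in u).
  by rewrite -rotE mem_rot inE.
have yv : y \in v.
  have := mem_zv y; rewrite yu orbT inE => /orP[/eqP yz|//].
  by move: le_zi lt_iy; rewrite yz; lia.
have [|p [x [p_in x_in px lt_i]]] := ascent_path v_path le_zi.
  by apply/hasP; exists y.
have /and4P[/eqP level_p /eqP level_x lt_label xU] :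
    [&& level p == i, level x == i.+1, label p < label x & ~~ decorated x].
  by move: px lt_i; rewrite /follows; case: (decorated x); lia.
have xu : x \in u.
  have := mem_zv x; rewrite inE x_in orbT => /esym/orP[/eqP xE|//].
  by rewrite xE in xU.
exists p, x; split=> //; have := mem_zv p; rewrite p_in => /esym/orP[/eqP pE|//].
rewrite pE in lt_label.
by have := ltn_trans lt_label (allP ltuN x xu); rewrite ltnn.
Qed.

Lemma runs_cons x sigma : runs (x :: sigma) =
  if runs sigma is (z :: r) :: rs then
    if z.1 < x.1 then (x :: z :: r) :: rs else [:: x] :: (z :: r) :: rs
  else [:: [:: x]].
Proof. by []. Qed.

Lemma head_runs x sigma : exists r rs, runs (x :: sigma) = (x :: r) :: rs.
Proof.
rewrite runs_cons; case: (runs sigma) => [|[|z r] rs]; try by exists [::], [::].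
by case: ifP => _; [exists (z :: r), rs|exists [::], ((z :: r) :: rs)].
Qed.

Definition decreasing (r : seq (nat * bool)) : bool := sorted (fun x y => y.1 < x.1) r.

Lemma runs_cat r sigma : r != [::] -> decreasing r ->
  (if sigma is y :: _ then (last y r).1 <= y.1 else true) ->
  runs (r ++ sigma) = r :: runs sigma.
Proof.
elim: r => [|x r IH] // _; case: r IH => [|y r] IH r_decr le_last.
  case: sigma le_last {IH r_decr} => [|y sigma] // le_xy; rewrite cat1s runs_cons.
  by have [r [rs ->]] := head_runs y sigma; rewrite ltnNge le_xy.
have /andP[lt_yx yr_decr] := r_decr.
have runsE : runs ((y :: r) ++ sigma) = (y :: r) :: runs sigma.
  by apply: IH => //; case: (sigma) le_last.
by rewrite cat_cons runs_cons runsE lt_yx.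
Qed.

Lemma runs_flatten (rs : seq (seq (nat * bool))) d :
  all (fun r => (r != [::]) && decreasing r) rs ->
  sorted (fun r r' => (last d r).1 <= (head d r').1) rs ->
  runs (flatten rs) = rs.
Proof.
elim: rs => [|r rs IH] //= /andP[/andP[rn0 r_decr] rs_decr] rs_sorted.
rewrite runs_cat ?IH ?(path_sorted rs_sorted) //.
case: rs rs_decr rs_sorted {IH} => [|[|y r'] rs] //= _ /andP[le_last _].
by case: r rn0 le_last {r_decr}.
Qed.

Lemma rhoE P i : 0 < nb_north P ->
  rho P i =
  sort (fun x y : nat * bool => y.1 <= x.1) [seq x.2 | x <- word P & level x == i].
Proof.
move=> P_gt0; rewrite /rho /word zip_area_word_letters filter_map -map_comp; congr sort.
have [_ ge0] := shiftP P_gt0; congr map; apply: eq_in_filter => v v_in.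
have : (0 <= v.1 + (shift P)%:Z)%R by apply: ge0; rewrite area_wordE map_f.
by rewrite /level /=; lia.
Qed.

Lemma mem_rho P i c : 0 < nb_north P -> (c \in rho P i) = ((i, c) \in word P).
Proof.
move=> P_gt0; rewrite rhoE // mem_sort; apply/mapP/idP => [[[l d]]|c_in].
  by rewrite mem_filter => /andP[/eqP /= <-] /[swap] ->.
by exists (i, c); rewrite // mem_filter eqxx.
Qed.

Lemma count_urun_rho P i (f : pred nat) : 0 < nb_north P ->
  count f [seq d.1 | d <- rho P i & ~~ d.2] = count f (ulevel (word P) i).
Proof.
move=> P_gt0; rewrite rhoE // count_map count_filter (permP (permEl (perm_sort _ _))).
by rewrite count_map count_ulevel count_filter; apply: eq_count => x /=; rewrite andbA.
Qed.

Lemma level0_word P : 0 < nb_north P -> 0 \in map level (word P).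
Proof.
move=> P_gt0; have [shift_in _] := shiftP P_gt0.
move: shift_in; rewrite area_word_levels // => /mapP[x xu levelE].
by apply/mapP; exists x => //; lia.
Qed.

Definition max_level (u : seq letter) : nat := \max_(x <- u) level x.

Lemma level_le_max u x : x \in u -> level x <= max_level u.
Proof. by move=> xu; apply: leq_bigmax_seq. Qed.

Lemma max_level_exists u : u != [::] -> max_level u \in map level u.
Proof.
rewrite /max_level; elim: u => [|x u IH] // _; rewrite big_cons.
have [->|un0] := eqVneq u [::]; first by rewrite big_nil maxn0 mem_head.
by rewrite /maxn; case: ifP => _; rewrite ?mem_head // inE IH // orbT.
Qed.

Section ScheduleWord.
Variables (n N : nat) (P : lpath).
Hypotheses (n_gt0 : 0 < n) (squareP : square_path n P) (uniqP : uniq (labels P)).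
Hypotheses (ltPN : labels_lt N (word P)) (P_valid : valid N (shift P) (word P)).

Let northP : nb_north P = n. Proof. exact: square_path_north squareP. Qed.
Let north_gt0 : 0 < nb_north P. Proof. by rewrite northP. Qed.
Let word_n0 : word P != [::]. Proof. exact: word_neq_nil n_gt0 squareP. Qed.
Let nlevels := (max_level (word P)).+1.

Lemma rho_nil i : nlevels <= i -> rho P i = [::].
Proof.
move=> le_i; case E: (rho P i) (mem_rho i ^~ north_gt0) => [|c r] // mem_r.
have := mem_r c; rewrite mem_head => /esym/level_le_max.
by rewrite /level /= leqNgt le_i.
Qed.

Lemma uniq_labels_rho i : uniq (map fst (rho P i)).
Proof.
rewrite rhoE // (perm_uniq (perm_map _ (permEl (perm_sort _ _)))) -map_comp.
by move: uniqP; rewrite labels_word; apply/subseq_uniq/map_subseq/filter_subseq.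
Qed.

Lemma rho_decreasing i : decreasing (rho P i).
Proof.
suff : sorted gtn (map fst (rho P i)) by rewrite sorted_map.
rewrite gtn_sorted_uniq_geq uniq_labels_rho sorted_map rhoE //.
by apply: sort_sorted => x y; apply: leq_total.
Qed.

Lemma ascent_in_word i : i.+1 < nlevels -> exists p x,
  [/\ p \in rho P i, x \in rho P i.+1 & p.1 < x.1].
Proof.
move=> lti; have [||p [x [p_in x_in level_p level_x lt_label]]] :=
    @ascent_exists N (shift P) (word P) i ltPN P_valid.
- have /mapP[z zu level_z] := level0_word north_gt0.
  by apply/hasP; exists z; rewrite // -level_z.
- have /mapP[z zu level_z] := max_level_exists word_n0.
  by apply/hasP; exists z; rewrite // -level_z.
by exists p.2, x.2; rewrite !mem_rho // -level_x -level_p /level -!surjective_pairing.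
Qed.

Lemma rho_neq_nil i : i < nlevels -> rho P i != [::].
Proof.
case: i => [_|i /ascent_in_word[_ [x [_ x_in _]]]]; last by case: (rho P i.+1) x_in.
case/mapP: (level0_word north_gt0) => -[l c] x_in /= level_x.
by have := mem_rho 0 c north_gt0; rewrite level_x x_in; case: (rho P l).
Qed.

Lemma dw_nlevels : dw P = flatten [seq rho P i | i <- iota 0 nlevels].
Proof.
have le_size : nlevels <= size P.
  have /mapP[x xu levelE] := max_level_exists word_n0.
  have /and3P[/eqP-> _ _] := squareP.
  by rewrite /nlevels levelE; apply: (allP (level_lt n_gt0 squareP)).
rewrite /dw -(subnKC le_size) iotaD map_cat flatten_cat add0n.
rewrite [X in _ ++ X](_ : _ = [::]) ?cats0 //.
apply/nilP; rewrite /nilp size_flatten sumnE !big_map big_seq big1 // => i.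
by rewrite mem_iota => /andP[le_i _]; rewrite rho_nil.
Qed.

Lemma runs_dw : runs (dw P) = [seq rho P i | i <- iota 0 nlevels].
Proof.
rewrite dw_nlevels; apply: (runs_flatten (d := (0, false))).
  apply/allP => r /mapP[i]; rewrite mem_iota => /= lti ->.
  by rewrite rho_neq_nil // rho_decreasing.
apply/(sortedP [::]) => i; rewrite size_map size_iota => ltSi.
rewrite !(nth_map 0) ?size_iota ?(ltnW ltSi) // !nth_iota ?(ltnW ltSi) // !add0n.
have [p [x [p_in x_in lt_px]]] := ascent_in_word ltSi.
have lt_trans : transitive (fun x y : nat * bool => y.1 < x.1).
  by move=> b a c lt_ba lt_cb; apply: ltn_trans lt_cb lt_ba.
have le_last : (last (0, false) (rho P i)).1 <= p.1.
  have := rho_decreasing i; rewrite /decreasing (sorted_pairwise lt_trans).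
  case/lastP: (rho P i) p_in => // r z; rewrite mem_rcons last_rcons pairwise_rcons.
  by case/predU1P=> [->//|pr] /andP[/allP/(_ p pr)/ltnW].
have le_head : x.1 <= (head (0, false) (rho P i.+1)).1.
  have := rho_decreasing i.+1; case: (rho P i.+1) x_in => // z r.
  by case/predU1P=> [->//|xr] /(order_path_min lt_trans)/allP/(_ x xr)/ltnW.
exact: leq_trans le_last (leq_trans (ltnW lt_px) le_head).
Qed.

Lemma perm_rho_word : perm_eq [seq (i, c) | i <- iota 0 nlevels, c <- rho P i] (word P).
Proof.
apply: uniq_perm.
- apply: allpairs_uniq_dep => [|i _|]; first exact: iota_uniq.
    exact: map_uniq (uniq_labels_rho i).
  by move=> [a b] [c d] _ _ [-> ->].
- by apply: (@map_uniq _ _ label); rewrite -labels_word.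
move=> [i c]; apply/allpairsPdep/idP => [[j [d [_ d_in [-> ->]]]]|c_in].
  by rewrite -mem_rho.
exists i, c; rewrite mem_rho // mem_iota add0n ltnS; split=> //.
exact: level_le_max c_in.
Qed.

Lemma perm_sched :
  perm_eq (sched P) [seq schedule (shift P) (word P) c | c <- word P].
Proof.
have nth_rho j : nth [::] [seq rho P i | i <- iota 0 nlevels] j = rho P j.
  have [ltj|lej] := ltnP j nlevels; first by rewrite (nth_map 0) ?size_iota // nth_iota.
  by rewrite nth_default ?size_map ?size_iota // rho_nil.
have lt_shift : shift P < nlevels.
  have := last_word_follows_marker n_gt0 squareP ltPN; rewrite follows_marker; last first.
    by rewrite (allP ltPN) // mem_nth // size_word northP prednK.
  move=> /leq_ltn_trans; apply; rewrite ltnS level_le_max // mem_nth // size_word northP.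
  by rewrite prednK.
have -> : sched P =
    [seq schedule (shift P) (word P) (i, c) | i <- iota 0 nlevels, c <- rho P i].
  rewrite /sched /sched_word runs_dw size_map size_iota lt_shift.
  congr (flatten _); apply: eq_map => i; rewrite nth_rho; apply: eq_map => c.
  by rewrite /sched_num /urun !nth_rho !count_urun_rho // addn1.
by apply: perm_trans (perm_map _ perm_rho_word); rewrite map_allpairs.
Qed.

Lemma sched_eq_nseq1 : (sched P == nseq n 1) = schedules (pred1 1) (shift P) (word P).
Proof.
have <- : size (sched P) = n by rewrite (perm_size perm_sched) size_map size_word.
transitivity (all (pred1 1) (sched P)); first exact/eqP/all_pred1P.
by rewrite (perm_all _ perm_sched) all_map.
Qed.

End ScheduleWord.

(** * Classes of paths with the same letters *)

Lemma to_lpath_inj n : injective (@to_lpath n).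
Proof.
move=> P Q /inj_map E; apply/val_inj/E => -[[a b]|] [[c d]|] //= [ac ->].
by rewrite (ord_inj ac).
Qed.

Lemma to_lpath_surj n (Q : lpath) :
  size Q = n + n -> all (fun c => c < n.+1) (labels Q) ->
  exists P : stpath n, to_lpath P = Q.
Proof.
move=> sizeQ ltQn; pose to_ord (x : nat * bool) : 'I_n.+1 * bool := (inord x.1, x.2).
have size_to_ord : size [seq omap to_ord y | y <- Q] == n + n by rewrite size_map sizeQ.
exists (Tuple size_to_ord); rewrite /to_lpath /= -map_comp.
move: ltQn; rewrite /labels /letters; elim: (Q) => [|[[a b]|] R IH] //=.
  by move=> /andP[lt_an /IH->]; rewrite inordK.
by move=> /IH->.
Qed.

Section Classes.
Variables (n k : nat).
Hypothesis n_gt0 : 0 < n.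
Implicit Types P Q : stpath n.

Local Notation pshift P := (shift (to_lpath P)).
Local Notation pword P := (word (to_lpath P)).

Definition standard_word (u : seq letter) : bool :=
  [&& perm_eq (map label u) (iota 1 n), count decorated u == k & 0 \in map level u].

Lemma perm_standard_word u v : perm_eq u v -> standard_word u = standard_word v.
Proof.
move=> uv; rewrite /standard_word (permP uv) (perm_mem (perm_map level uv)).
by rewrite (permPl (perm_map label uv)).
Qed.

Lemma standard_labels_lt u : perm_eq (map label u) (iota 1 n) -> labels_lt n.+1 u.
Proof.
move=> labelsE; apply/allP => d /(map_f label).
by rewrite (perm_mem labelsE) mem_iota => /andP[].
Qed.

Lemma standard_wordP u : standard_word u ->
  [/\ u != [::], uniq (map label u), labels_lt n.+1 u & size u = n].
Proof.
case/and3P=> labelsE _ _.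
have sizeu : size u = n by rewrite -(size_map label) (perm_size labelsE) size_iota.
split=> //; last exact: standard_labels_lt.
  by rewrite -size_eq0 sizeu -lt0n.
by rewrite (perm_uniq labelsE) iota_uniq.
Qed.

Lemma stLSQP P : P \in stLSQ n k ->
  [/\ square_path n (to_lpath P), standard_word (pword P)
    & valid n.+1 (pshift P) (pword P)].
Proof.
rewrite inE => /andP[lsqP]; have squareP : square_path n (to_lpath P) by case/and4P: lsqP.
rewrite /standard labels_word => labelsE; have ltPn := standard_labels_lt labelsE.
move: lsqP; rewrite (LSQ_word n_gt0 squareP ltPn); last first.
  by rewrite labels_word (perm_uniq labelsE) iota_uniq.
move=> /and3P[_ P_valid decE]; split=> //.
rewrite /standard_word labelsE decE level0_word //.
by rewrite (square_path_north squareP).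
Qed.

Lemma stLSQ_north_gt0 P : P \in stLSQ n k -> 0 < nb_north (to_lpath P).
Proof. by case/stLSQP=> squareP _ _; rewrite (square_path_north squareP). Qed.

Lemma stLSQ_exists s u : standard_word u -> valid n.+1 s u ->
  exists2 P, P \in stLSQ n k & (pshift P, pword P) = (s, u).
Proof.
move=> u_std u_valid; have [un0 uniqu ltun sizeu] := standard_wordP u_std.
have /and3P[labelsE decE level0] := u_std.
have [squareP shiftE wordE] := word_build_path n_gt0 sizeu ltun level0 u_valid.
have labelsP : labels (build_path s s u) = map label u by rewrite labels_word wordE.
have [||P PE] := @to_lpath_surj n (build_path s s u).
- by case/and3P: squareP => /eqP.
- by rewrite labelsP all_map.
exists P; last by rewrite PE shiftE wordE.
rewrite inE PE /standard (LSQ_word (N := n.+1)) ?labelsP ?wordE ?shiftE //.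
rewrite u_valid decE labelsE !andbT; apply/allP => c.
by rewrite (perm_mem labelsE) mem_iota => /andP[].
Qed.

Lemma shift_word_inj P Q : P \in stLSQ n k -> Q \in stLSQ n k ->
  (pshift P, pword P) = (pshift Q, pword Q) -> P = Q.
Proof.
move=> /stLSQP[squareP _ _] /stLSQP[squareQ _ _] [shiftE wordE]; apply: to_lpath_inj.
by rewrite -(build_path_word n_gt0 squareP) -(build_path_word n_gt0 squareQ) shiftE wordE.
Qed.

Lemma mem_sched_one P : P \in stLSQ n k ->
  (P \in sched_one n k) = schedules (pred1 1) (pshift P) (pword P).
Proof.
move=> P_in; have [squareP P_std P_valid] := stLSQP P_in.
have [_ uniqP ltPn _] := standard_wordP P_std.
by rewrite inE P_in (sched_eq_nseq1 n_gt0 squareP _ ltPn P_valid) ?labels_word.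
Qed.

Lemma sched_one_in_stLSQ P : P \in sched_one n k -> P \in stLSQ n k.
Proof. by rewrite inE => /andP[]. Qed.

Definition same_letters P Q : bool := perm_eq (pword P) (pword Q).

Definition letter_class P : {set stpath n} := [set Q in stLSQ n k | same_letters P Q].

Definition letter_classes : {set {set stpath n}} :=
  equivalence_partition same_letters (stLSQ n k).

Lemma letter_classesP A :
  reflect (exists2 P, P \in stLSQ n k & A = letter_class P) (A \in letter_classes).
Proof. exact: imsetP. Qed.

Lemma mem_letter_class P : P \in stLSQ n k -> P \in letter_class P.
Proof. by move=> P_in; rewrite inE P_in /same_letters perm_refl. Qed.

Lemma letter_class_eq P Q : Q \in letter_class P -> letter_class Q = letter_class P.
Proof.
rewrite inE => /andP[_ PQ]; apply/setP => Q'.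
by rewrite !inE /same_letters (permPl PQ).
Qed.

Lemma letter_classes_partition : partition letter_classes (stLSQ n k).
Proof.
apply: equivalence_partitionP => P Q Q' _ _ _; split; first exact: perm_refl.
by rewrite /same_letters => /permPl->.
Qed.

Lemma area_letter_class P Q : P \in stLSQ n k -> Q \in letter_class P ->
  area (to_lpath Q) = area (to_lpath P).
Proof.
move=> P_in; rewrite inE => /andP[Q_in PQ]; rewrite !area_levels ?stLSQ_north_gt0 //.
by apply/perm_sumn/perm_map; rewrite perm_sym.
Qed.

Lemma class_area_sub P (C : {set stpath n}) : P \in stLSQ n k ->
  C \subset letter_class P -> C != set0 -> class_area C = area (to_lpath P).
Proof.
move=> P_in /subsetP subC /set0Pn[Q QC]; rewrite /class_area.
by case: pickP => [Q' /subC/(area_letter_class P_in)|/(_ Q)] //; rewrite QC.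
Qed.

Lemma class_area_letter_class P : P \in stLSQ n k ->
  class_area (letter_class P) = area (to_lpath P).
Proof.
move=> P_in; apply: class_area_sub => //.
by apply/set0Pn; exists P; apply: mem_letter_class.
Qed.

Lemma perm_shift_word_class P : P \in stLSQ n k ->
  perm_eq [seq (pshift Q, pword Q) | Q <- enum (letter_class P)]
    [seq p <- [seq (s, u) | s <- iota 0 (n + n), u <- permutations (pword P)]
      | valid n.+1 p.1 p.2].
Proof.
move=> P_in; have [_ P_std _] := stLSQP P_in; have [_ uniqP _ _] := standard_wordP P_std.
apply: uniq_perm.
- rewrite map_inj_in_uniq ?enum_uniq // => Q Q'; rewrite !mem_enum.
  by move=> /setIdP[Q_in _] /setIdP[Q'_in _]; apply: shift_word_inj.
- apply: filter_uniq; apply: allpairs_uniq; rewrite ?iota_uniq ?permutations_uniq //.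
  by move=> [a b] [c d].
move=> [s u]; rewrite mem_filter /=; apply/mapP/andP => [[Q]|[u_valid]].
  rewrite mem_enum => /setIdP[/stLSQP[squareQ Q_std Q_valid] PQ] [-> ->]; split=> //.
  apply: allpairs_f; last by rewrite mem_permutations perm_sym.
  by rewrite mem_iota /= add0n ltn_addr // shift_lt.
case/allpairsP=> -[_ v] /= [_ + [_ uv]]; rewrite -{}uv mem_permutations => permu.
have [|Q Q_in QE] := stLSQ_exists _ u_valid; first by rewrite (perm_standard_word permu).
exists Q; rewrite ?mem_enum //; case: QE => _ wordQ.
by rewrite inE Q_in /same_letters wordQ perm_sym.
Qed.

Definition path_sign P : int := ((-1) ^+ sign_exponent (pshift P) (pword P))%R.

Lemma sum_sign_letter_class P : P \in stLSQ n k ->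
  (\sum_(Q in letter_class P) path_sign Q
   = \sum_(0 <= s < n + n) signed_sum n.+1 (pword P) s)%R.
Proof.
move=> P_in; pose sign (p : nat * seq letter) : int := ((-1) ^+ sign_exponent p.1 p.2)%R.
transitivity
  (\sum_(p <- [seq (pshift Q, pword Q) | Q <- enum (letter_class P)]) sign p)%R.
  by rewrite big_map big_enum.
rewrite (perm_big _ (perm_shift_word_class P_in)) big_filter big_mkcond big_allpairs.
by rewrite /index_iota subn0; apply: eq_bigr => s _; rewrite -big_mkcond.
Qed.

Definition meets_sched_one (A : {set stpath n}) : bool := A :&: sched_one n k != set0.

Lemma letter_class_meets P : P \in stLSQ n k ->
  reflect (exists s, schedules (pred1 1) s (pword P)) (meets_sched_one (letter_class P)).
Proof.
move=> P_in; have [_ P_std _] := stLSQP P_in.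
have [_ uniqP ltPn _] := standard_wordP P_std.
apply: (iffP (set0Pn _)) => [[Q /setIP[/setIdP[Q_in PQ]]]|[s one_P]].
  by rewrite mem_sched_one // -(perm_schedules _ _ PQ); exists (pshift Q).
have [u permu u_valid] := valid_exists uniqP ltPn one_P.
have [|Q Q_in QE] := stLSQ_exists _ u_valid; first by rewrite (perm_standard_word permu).
case: QE => shiftQ wordQ; exists Q; rewrite in_setI mem_sched_one // inE Q_in.
by rewrite /same_letters shiftQ wordQ perm_sym permu (perm_schedules _ _ permu).
Qed.

Lemma sum_path_sign A : A \in letter_classes ->
  (\sum_(P in A) path_sign P = (odd (absz (n%:Z - k%:Z)) && meets_sched_one A)%:R)%R.
Proof.
case/letter_classesP=> P P_in ->; rewrite sum_sign_letter_class //.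
have [squareP P_std _] := stLSQP P_in.
have [Pn0 uniqP ltPn sizeP] := standard_wordP P_std.
have [[s one_P]|not_one] := letter_class_meets P_in; last first.
  rewrite andbF sum_signed_not_one // => s; apply/negP => one_P.
  by apply: not_one; exists s.
rewrite andbT (sum_signed_one Pn0 uniqP ltPn (level_lt n_gt0 squareP) one_P).
congr (_%:R)%R; congr nat_of_bool; have := count_predC decorated (pword P).
by case/and3P: P_std => _ /eqP-> _; rewrite sizeP; set m := count _ _; lia.
Qed.

Lemma S_poly_letter_classes :
  (S_poly n k =
   \sum_(A in letter_classes) (\sum_(P in A) path_sign P) *: 'X^(class_area A))%R.
Proof.
rewrite /S_poly (set_partition_big _ letter_classes_partition) /=.
apply: eq_bigr => _ /letter_classesP[P P_in ->]; rewrite scaler_suml.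
apply: eq_bigr => Q /[dup] PQ /setIdP[Q_in _].
rewrite (area_letter_class P_in PQ) class_area_letter_class //.
by rewrite sign_dinv // stLSQ_north_gt0.
Qed.

Lemma cut_equiv_same_letters P Q : P \in sched_one n k -> Q \in sched_one n k ->
  cut_equiv n k (to_lpath P) (to_lpath Q) = same_letters P Q.
Proof.
move=> P_one Q_one.
have [P_in Q_in] := (sched_one_in_stLSQ P_one, sched_one_in_stLSQ Q_one).
have [squareP P_std P_valid] := stLSQP P_in.
have [Pn0 uniqP ltPn _] := standard_wordP P_std.
have [squareQ Q_std Q_valid] := stLSQP Q_in.
apply/idP/idP => [/(cut_equiv_perm_word n_gt0 squareP)|PQ].
  by rewrite /same_letters perm_sym.
have one_P : schedules (pred1 1) (pshift Q) (pword P).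
  by rewrite (perm_schedules _ _ PQ) -mem_sched_one.
have size_level : size (ulevel (pword P) (pshift Q)) = 1.
  exact: schedules_odd_size uniqP Pn0 (schedules_one_odd one_P).
have [|u1 [u2 [wordE cut_valid le_last le_head]]] :=
    valid_cut (s' := pshift Q) ltPn P_valid.
  by rewrite size_level.
have wordQ : u2 ++ u1 = pword Q.
  apply: (valid_unique uniqP ltPn one_P) => //; last by rewrite perm_sym.
  by rewrite wordE perm_catC.
rewrite -[to_lpath Q](build_path_word n_gt0 squareQ) -wordQ.
apply: cut_equiv_build_path n_gt0 squareP ltPn P_valid wordE le_last le_head _.
by rewrite wordQ (build_path_word n_gt0 squareQ); case/setIdP: Q_in.
Qed.

Lemma cut_classesE :
  cut_classes n k = [set A :&: sched_one n k | A in letter_classes & meets_sched_one A].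
Proof.
have cut_class P : P \in sched_one n k ->
    [set Q in sched_one n k | cut_equiv n k (to_lpath P) (to_lpath Q)]
    = letter_class P :&: sched_one n k.
  move=> P_one; apply/setP => Q; rewrite inE in_setI [Q \in letter_class _]inE andbC.
  have [Q_one|_] := boolP (Q \in sched_one n k); last by rewrite !andbF.
  by rewrite cut_equiv_same_letters // sched_one_in_stLSQ.
apply/setP => C; apply/imsetP/imsetP => [[P P_one ->]|[A /setIdP[]]].
  exists (letter_class P); last exact: cut_class.
  have P_in := sched_one_in_stLSQ P_one.
  apply/setIdP; split; first by apply/letter_classesP; exists P.
  by apply/set0Pn; exists P; rewrite in_setI mem_letter_class.
case/letter_classesP=> P P_in -> /set0Pn[Q /setIP[PQ Q_one]] ->.
by exists Q => //; rewrite cut_class // (letter_class_eq PQ).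
Qed.

Lemma sum_cut_classes :
  (\sum_(C in cut_classes n k) 'X^(class_area C)
   = \sum_(A in letter_classes | meets_sched_one A) 'X^(class_area A) :> {poly int})%R.
Proof.
rewrite cut_classesE big_imset /= => [|A B]; last first.
  move=> /setIdP[/letter_classesP[P _ ->] /set0Pn[R RP]].
  move=> /setIdP[/letter_classesP[Q _ ->] _] PQ.
  have := RP; rewrite PQ => /setIP[/letter_class_eq<- _].
  by case/setIP: RP => /letter_class_eq.
apply: eq_big => A; first by rewrite inE.
case/setIdP=> /letter_classesP[P P_in ->] P_meets.
by rewrite class_area_letter_class // (class_area_sub P_in) ?subsetIl.
Qed.

End Classes.

Local Open Scope ring_scope.

Theorem mainTheorem2 (n k : nat) (n_gt0 : (0 < n)%N) :
  S_poly n k =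
    if odd (absz (n%:Z - k%:Z))
    then \sum_(C in cut_classes n k) 'X^(class_area C)
    else 0.
Proof.
rewrite S_poly_letter_classes // sum_cut_classes //.
have scaleE A : A \in letter_classes n k ->
    (\sum_(P in A) path_sign P) *: 'X^(class_area A)
    = if odd (absz (n%:Z - k%:Z)) && meets_sched_one k A then 'X^(class_area A) else 0.
  by move=> /sum_path_sign->; rewrite // scaler_nat; case: (_ && _).
rewrite (eq_bigr _ scaleE); case: (odd _) => /=; last exact: big1.
by rewrite -big_mkcondr.
Qed.
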